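(* Let $K\in\{2,3,\dots\}$, $\mathbf{w}=(w_1,\dots,w_K)\in\Delta_K$, $r\in[1,\infty)$, and $w:=\max_{k=1,\dots,K}w_k$. Then the function $\min\left(r+1,\frac1w\right)^{1/r}M_{r,\mathbf{w}}$ on $[0,1]^K$ is a precise merging function.
   Context: $\Delta_K:=\{(w_1,\dots,w_K)\in[0,1]^K\mid w_1+\dots+w_K=1\}$. For $r\in[1,\infty)$, $M_{r,\mathbf{w}}(p_1,\dots,p_K):=\left(w_1p_1^r+\dots+w_Kp_K^r\right)^{1/r}$ on $[0,1]^K$. Fix an atomless probability space and let $\mathcal{U}$ be the set of all random variables on it uniformly distributed on $[0,1]$. A merging function is a Borel function $F:[0,1]^K\to[0,\infty)$, increasing (in the weak sense) in each argument, such that for each $\epsilon\in(0,1)$, $\sup\{\mathbb{P}(F(U_1,\dots,U_K)\le\epsilon)\mid U_1,\dots,U_K\in\mathcal{U}\}\le\epsilon$. It is precise if this supremum equals $\epsilon$ for each $\epsilon\in(0,1)$. *)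

(* Defs.v *)
From HB Require Import structures.
From mathcomp Require Import all_boot all_order all_algebra.
From mathcomp Require Import all_classical all_reals all_analysis.

Set Implicit Arguments.
Unset Strict Implicit.
Unset Printing Implicit Defensive.

Import Order.TTheory GRing.Theory Num.Theory.
Import numFieldNormedType.Exports.

Local Open Scope classical_set_scope.
Local Open Scope ring_scope.

Definition atomless (d : measure_display) (T : measurableType d) (R : realType)
    (P : probability T R) : Prop :=
  forall A : set T, measurable A -> (0 < P A)%E ->
    exists B : set T,
      [/\ measurable B, B `<=` A, (0 < P B)%E & (P B < P A)%E].

(* The law is compared with the uniform one on Borel sets only: the values of
   these set functions elsewhere are meaningless. *)
Definition uniform01 (d : measure_display) (T : measurableType d)
    (R : realType) (P : probability T R) (U : {RV P >-> R}) : Prop :=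
  forall A : set R, measurable A ->
    distribution P U A = uniform_prob (@ltr01 R) A.

Definition cube (R : realType) (K : nat) : set (K.-tuple R) :=
  [set x | forall k : 'I_K, 0 <= tnth x k <= 1].

Definition simplex (R : realType) (K : nat) : set (K.-tuple R) :=
  [set w | cube w /\ \sum_(k < K) tnth w k = 1].

(* A function F on [0,1]^K is represented by a total function on K-tuples, of
   which only the restriction to the cube matters.  Accordingly, the event
   {F(U_1, ..., U_K) <= eps} includes the almost sure condition that
   (U_1, ..., U_K) lies in the cube, as a uniform random variable may leave
   [0,1] on a null set. *)
Definition merging_event (d : measure_display) (T : measurableType d)
    (R : realType) (P : probability T R) (K : nat) (F : K.-tuple R -> R)
    (U : 'I_K -> {RV P >-> R}) (eps : R) : set T :=
  [set t | let u := [tuple U k t | k < K] in cube u /\ F u <= eps].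

Definition merging_sup (d : measure_display) (T : measurableType d)
    (R : realType) (P : probability T R) (K : nat) (F : K.-tuple R -> R)
    (eps : R) : \bar R :=
  ereal_sup [set p | exists U : 'I_K -> {RV P >-> R},
    (forall k, uniform01 (U k)) /\ p = P (merging_event F U eps)].

(* The measurable structure on K.-tuple R is the product of the Borel
   sigma-algebras, that is, the Borel sigma-algebra of R^K. *)
Definition merging_function (d : measure_display) (T : measurableType d)
    (R : realType) (P : probability T R) (K : nat) (F : K.-tuple R -> R)
    : Prop :=
  [/\ measurable_fun (@cube R K) F,
      (forall x, cube x -> 0 <= F x),
      (forall (k : 'I_K) (x y : K.-tuple R), cube x -> cube y ->
         (forall j, j != k -> tnth x j = tnth y j) ->
         tnth x k <= tnth y k -> F x <= F y) &
      (forall eps : R, 0 < eps < 1 -> (merging_sup P F eps <= eps%:E)%E)].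

Definition precise_merging_function (d : measure_display)
    (T : measurableType d) (R : realType) (P : probability T R) (K : nat)
    (F : K.-tuple R -> R) : Prop :=
  merging_function P F /\
  (forall eps : R, 0 < eps < 1 -> merging_sup P F eps = eps%:E).

Definition weighted_mean (R : realType) (K : nat) (r : R) (w : K.-tuple R)
    (p : K.-tuple R) : R :=
  (\sum_(k < K) tnth w k * tnth p k `^ r) `^ r^-1.

(* On the simplex all weights are nonnegative, so the initial value 0 does not
   affect the maximum. *)
Definition max_weight (R : realType) (K : nat) (w : K.-tuple R) : R :=
  \big[Num.max/0]_(k < K) tnth w k.

(* Main.v *)
Require Import Defs.
From mathcomp Require Import all_boot all_order all_algebra.
From mathcomp Require Import all_classical all_reals all_analysis.
From mathcomp Require Import measurable_realfun.
From mathcomp Require Import zify ring lra.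
Import Order.TTheory GRing.Theory Num.Theory.
Import numFieldNormedType.Exports.
Local Open Scope classical_set_scope.
Local Open Scope ring_scope.
Set Implicit Arguments.
Unset Strict Implicit.

(** Write c for min (r + 1) (1 / max w), so that the function raised to the
    power r is c times the weighted sum of the p_k ^ r.

    Validity.  If c = 1 / max w, the function dominates one of its arguments.
    If c = r + 1, the tail bound [weighted_power_tail] is linear programming
    duality with an explicit dual solution: with
    g(u) = (r + 1) / (r e^r) * (e^r - u^r) on [0, e] and g = 0 elsewhere, the
    weighted sum of the g(U_k) is at least 1 on the event while each g(U_k)
    has expectation e.

    Precision.  Given e' < e, uniform variables have to be coupled so that the
    event has probability at least e'.  On a set of probability e' they are
    taken uniform on [0, e'], so that one has to couple uniform V_k on [0, 1]
    with the sum of the w_k V_k^r bounded by 1 / c up to a small error.  The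
    variable w_k V_k^r has a decreasing density on [0, w_k] and mean
    w_k / (r + 1); since 1 / c is the maximum of max w and 1 / (r + 1), the
    statement is an instance of: variables with decreasing densities, supports
    in [0, m] and means of total at most m can be coupled with a sum bounded
    by m.  [joint_mix] is a discrete version, on {0, ..., n} and with an
    additive error which is independent of n.

    The proof of [joint_mix] exhausts the given decreasing mass functions by
    couplings of simple pieces: uniform laws on intervals {c_k - l_k, ..., c_k}
    whose right ends c_k are drop points, so that removing a little of such a
    law leaves a decreasing function.  Keeping the total mean at most n times
    the mass is the invariant which guarantees that there are drop points with
    n <= sum c_k <= 2n (move them one at a time from the first to the last drop
    of each function: each move changes the sum by at most n), unless already
    the last drops have a sum at most n, in which case the point mass at these
    drops can be removed.  For such c_k the lengths l_k can be chosen so that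
    the uniform laws are coupled with an almost constant sum, and with mean n
    ([choose_lengths], [coupled_uniforms]).  Instead of iterating, one takes by
    compactness a partial coupling of maximal mass ([polytope_max]); the
    previous construction shows that its mass is 1 ([extend_coupling]).

    Uniform laws are coupled by reduction to three groups, in each of which
    all variables move together; the three group sums, with lengths satisfying
    the triangle inequality, have constant total when the vector of positions
    runs along the sides of a suitable triangle (section [triangle]).

    Finally the coupling is transported to the given probability space.  An
    atomless space carries a variable h in [0, 1) without atoms
    ([atomless_rv]), and the distribution function of any atomless variable,
    composed with it, is uniform ([integral_transform]).  Applied to h this
    splits the space into sets of prescribed probabilities ([finite_law]);
    applied to h plus an integer index it gives uniform variables which are
    ordered like the index ([layered_uniform]). *)

(** * Maximisation over polytopes, and finite-valued maps *)

Lemma continuous_sum_coord (R : realType) (I : finType) (Q : pred I) :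
  continuous (fun v : 'rV[R]_#|I| => \sum_(i | Q i) v ord0 (enum_rank i)).
Proof.
move=> v; apply: (@cvg_big _ _ _ _ _ add_continuous _ (nbhs v)) => i _.
exact: coord_continuous.
Qed.

(** A function h is maximised over a bounded set cut out by continuous
    inequalities.  Vectors are plain functions on I; the row matrices indexed
    by the enumeration of I only serve to import compactness and continuity. *)
Lemma polytope_max (R : realType) (I : finType) (J : Type)
    (g : J -> (I -> R) -> R) (h : (I -> R) -> R) (B : R) :
  0 <= B ->
  (forall j, continuous (fun v : 'rV[R]_#|I| =>
     g j (fun i => v ord0 (enum_rank i)))) ->
  continuous (fun v : 'rV[R]_#|I| => h (fun i => v ord0 (enum_rank i))) ->
  (exists x, forall j, 0 <= g j x) ->
  (forall x, (forall j, 0 <= g j x) -> forall i, `|x i| <= B) ->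
  exists2 x, (forall j, 0 <= g j x) &
    forall y, (forall j, 0 <= g j y) -> h y <= h x.
Proof.
move=> B0 gc hc [x0 x0A] bA.
pose toF (v : 'rV[R]_#|I|) := fun i => v ord0 (enum_rank i).
pose toV (x : I -> R) : 'rV[R]_#|I| := \row_j x (enum_val j).
have toVK x : toF (toV x) = x.
  by apply/funext => i; rewrite /toF mxE enum_rankK.
pose A := [set v | forall j, 0 <= g j (toF v)].
have A0 : A !=set0 by exists (toV x0) => j; rewrite toVK.
have Ac : closed A.
  rewrite (_ : A = \bigcap_(j in setT)
    ((fun v => g j (toF v)) @^-1` [set y | 0 <= y])); last first.
    by apply/seteqP; split=> v; [move=> Av j _; exact: Av|
      move=> Av j; exact: Av].
  apply: closed_bigI => j _; apply: preimage_closed; first by move=> v _;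
    exact: (gc j v).
  exact: (@closed_ge R 0).
have Ab : bounded_set A.
  exists B; split; first exact: num_real.
  move=> M BM v Av /=; rewrite [leLHS]/Num.norm /= mx_normrE.
  apply/bigmax_leP; split => [|[i j] _] /=; first exact: le_trans B0 (ltW BM).
  rewrite ord1 -[j]enum_valK;
    exact: le_trans (bA (toF v) Av (enum_val j)) (ltW BM).
have /= [c cA cM] := @compact_EVT_max _ R (fun v => h (toF v)) A A0
  (bounded_closed_compact Ab Ac) (continuous_subspaceT hc).
exists (toF c); first by move: cA; rewrite inE.
move=> y yA; rewrite -[y]toVK; apply: cM; rewrite inE => j; rewrite toVK.
exact: yA.
Qed.

Lemma sum_fibers d (T : measurableType d) (R : realType)
    (P : probability T R) (G : finType) (Y : T -> G) (Q : pred G) :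
  (forall x, measurable (Y @^-1` [set x])) ->
  \sum_(x | Q x) fine (P (Y @^-1` [set x])) = fine (P [set t | Q (Y t)]).
Proof.
move=> mY.
have -> : [set t | Q (Y t)] =
    \bigcup_(x in [set x | Q x]) (Y @^-1` [set x]).
  apply/seteqP; split=> [t Qt|t [x /= Qx ->//]]; by exists (Y t).
rewrite measure_fin_bigcup//.
- rewrite sum_fine; last by move=> x _; exact: fin_num_measure.
  congr fine; rewrite (@bigfs _ _ _ _ (index_enum G)) ?index_enum_uniq//.
  by move=> x _; rewrite mem_index_enum.
- exact: finite_finset.
- by move=> x y _ _ [t [/= <- <-]].
Qed.

(** * Coupling three uniform variables with constant sum *)

Lemma uniform_prob_itv (R : realType) (A : set R) : measurable A ->
  uniform_prob (@ltr01 R) A = lebesgue_measure (A `&` `[0, 1]).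
Proof.
move=> mA; rewrite /uniform_prob integral_uniform_pdf.
rewrite (eq_integral (cst 1%E)); last first.
  move=> x; rewrite inE => -[_ /=]; rewrite in_itv /= => x01.
  by rewrite /uniform_pdf x01 subr0 invr1.
by rewrite integral_cst ?mul1e//; exact: measurableI.
Qed.

Lemma uniform_prob_le (R : realType) (x : R) : 0 <= x <= 1 ->
  uniform_prob (@ltr01 R) `]-oo, x] = x%:E.
Proof.
move=> /andP[x0 x1]; rewrite uniform_prob_itv//.
rewrite (_ : _ `&` _ = `[0, x]%classic); last first.
  apply/seteqP; split=> y /=; rewrite !in_itv/=.
    by case=> -> /andP[-> _].
  by move=> /andP[-> yx]; split=> //=; exact: le_trans yx x1.
rewrite lebesgue_measure_itv/= lte_fin; case: ifPn => [_|].
  by rewrite -EFinB subr0.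
by rewrite -leNgt => x0'; congr EFin; apply/eqP; rewrite eq_le x0 x0'.
Qed.

Lemma uniform_prob_ge (R : realType) (x : R) : 0 <= x <= 1 ->
  uniform_prob (@ltr01 R) `[x, +oo[ = (1 - x)%:E.
Proof.
move=> /andP[x0 x1]; rewrite uniform_prob_itv//.
rewrite (_ : _ `&` _ = `[x, 1]%classic); last first.
  apply/seteqP; split=> y /=; rewrite !in_itv/= andbT.
    by case=> -> /andP[_ ->].
  by move=> /andP[xy ->]; rewrite xy (le_trans x0 xy).
rewrite lebesgue_measure_itv/= lte_fin; case: ifPn => [_//|].
rewrite -leNgt => x1'; have -> : x = 1 by apply/eqP; rewrite eq_le x1 x1'.
by rewrite subrr.
Qed.

Lemma uniform_prob_le_clip (R : realType) (x : R) :
  uniform_prob (@ltr01 R) `]-oo, x] = (Num.max 0 (Num.min 1 x))%:E.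
Proof.
have [x0|x0] := leP x 0.
  rewrite min_r ?(le_trans x0)// max_l//.
  apply/eqP; rewrite eq_le measure_ge0 andbT.
  rewrite -(@uniform_prob_le _ 0) ?lexx ?ler01//.
  apply: le_measure; rewrite ?inE//.
  by move=> y /=; rewrite !in_itv/= => /le_trans; apply.
have [x1|x1] := leP x 1.
  by rewrite max_r ?uniform_prob_le ?x1 ?(ltW x0) // ltW.
rewrite max_r//; apply/eqP; rewrite eq_le probability_le1//=.
rewrite -[X in (X <= _)%E](@uniform_prob_le _ 1) ?lexx ?ler01//.
apply: le_measure; rewrite ?inE//.
by move=> y /=; rewrite !in_itv/= => /le_trans; apply; exact: ltW.
Qed.

Lemma set_ge_mul_onem (R : realType) (t y : R) : 0 < t ->
  [set s : R | y <= (1 - s) * t] = `]-oo, 1 - y / t]%classic.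
Proof.
move=> t0; apply/seteqP; split=> s /=; rewrite in_itv/=.
  by rewrite -ler_pdivrMr// lerBrDr addrC -lerBrDr.
by rewrite -ler_pdivrMr// lerBrDr addrC -lerBrDr.
Qed.

Lemma set_ge_onem_mul (R : realType) (t y : R) : 0 < t ->
  [set s : R | y <= 1 - s * t] = `]-oo, (1 - y) / t]%classic.
Proof.
move=> t0; apply/seteqP; split=> s /=; rewrite in_itv/=.
  by rewrite ler_pdivlMr// lerBrDr addrC -lerBrDr.
by rewrite ler_pdivlMr// lerBrDr addrC -lerBrDr.
Qed.

(** A uniform variable on [0, 1] is a mixture of uniform variables on
    [0, p / (p + q)] and on [p / (p + q), 1], with weights proportional to p
    and q.  Both pieces are written as decreasing affine functions of one
    uniform parameter s. *)
Lemma folded_uniform_tail (R : realType) (p q y : R) :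
  0 < p -> 0 < q -> 0 <= y <= 1 ->
  p * fine (uniform_prob (@ltr01 R) [set s | y <= (1 - s) * (p / (p + q))]) +
  q * fine (uniform_prob (@ltr01 R) [set s | y <= 1 - s * (q / (p + q))]) =
  (p + q) * (1 - y).
Proof.
move=> p0 q0 /andP[y0 y1].
have pq0 : 0 < p + q by rewrite addr_gt0.
have yq : 0 <= y * q / p by rewrite divr_ge0 ?mulr_ge0// ltW.
have yp : 0 <= (1 - y) * p / q by rewrite divr_ge0 ?mulr_ge0 ?subr_ge0// ltW.
rewrite set_ge_mul_onem ?divr_gt0// set_ge_onem_mul ?divr_gt0//.
rewrite !uniform_prob_le_clip/= !invf_div !mulrA.
have -> : y * (p + q) / p = y + y * q / p by field; rewrite gt_eqF.
have -> : (1 - y) * (p + q) / q = 1 - y + (1 - y) * p / q.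
  by field; rewrite gt_eqF.
rewrite (@min_r _ _ 1 (1 - _)); last first.
  by rewrite gerBl addr_ge0.
rewrite (@max_r _ _ 0 (Num.min 1 _)); last first.
  by rewrite le_min ler01 addr_ge0// subr_ge0.
have [yp'|yp'] := leP (y * (p + q)) p.
  rewrite max_r; last first.
    rewrite -(ler_pM2l p0) mulr0.
    have -> : p * (1 - (y + y * q / p)) = p - y * (p + q).
      by field; rewrite gt_eqF.
    by rewrite subr_ge0.
  rewrite min_l; last first.
    rewrite -(ler_pM2l q0) mulr1.
    have -> : q * (1 - y + (1 - y) * p / q) = (1 - y) * (p + q).
      by field; rewrite gt_eqF.
    by lra.
  by field; rewrite gt_eqF.
rewrite max_l; last first.
  rewrite -(ler_pM2l p0) mulr0.
  have -> : p * (1 - (y + y * q / p)) = p - y * (p + q).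
    by field; rewrite gt_eqF.
  by rewrite subr_le0 ltW.
rewrite min_r; last first.
  rewrite -(ler_pM2l q0) mulr1.
  have -> : q * (1 - y + (1 - y) * p / q) = (1 - y) * (p + q).
    by field; rewrite gt_eqF.
  by lra.
by field; rewrite gt_eqF.
Qed.

(** In the plane where the sum of three coordinates is constant, consider a
    triangle such that coordinate g goes from 0 to its maximum [tri_len g] along
    side g, and back along the other two sides.  Such a triangle exists for all
    lengths satisfying the triangle inequalities strictly: they are the sums of
    two of three positive numbers z.  Side a is chosen with probability
    proportional to 1 / z a. *)
Section triangle.
Variables (R : realType) (z : 'I_3 -> R).

Definition tri_len (g : 'I_3) := \sum_(i | i != g) z i.

Definition tri_weight (a : 'I_3) := (z a)^-1 / \sum_i (z i)^-1.

(** The position of coordinate g, in units of [tri_len g], at time s on side a;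
    the other two sides are run through in cyclic order, which decides in which
    part of the descent coordinate g is. *)
Definition tri_coord (a g : 'I_3) (s : R) : R :=
  if g == a then s else
  let t := (tri_len g - z a) / tri_len g in
  if val g == ((val a).+1 %% 3)%N then (1 - s) * t else 1 - s * t.

Hypothesis z0 : forall i, 0 < z i.

Lemma tri_len_gt0 g : 0 < tri_len g.
Proof.
have [i ig] : exists i : 'I_3, i != g.
  by case: g => [[|m] gm]; [exists (inord 1)|exists ord0];
    rewrite -val_eqE/= ?inordK.
rewrite /tri_len (bigD1 i)//= ltr_pwDl// sumr_ge0// => j _; exact: ltW.
Qed.

Lemma tri_weight_ge0 a : 0 <= tri_weight a.
Proof.
by rewrite /tri_weight divr_ge0 ?invr_ge0 ?sumr_ge0// => *;
  rewrite ?invr_ge0 ltW.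
Qed.

Lemma sum_inv_neq0 : \sum_i (z i)^-1 != 0.
Proof.
rewrite gt_eqF// (bigD1 ord0)//= ltr_pwDl ?invr_gt0//.
by rewrite sumr_ge0// => i _; rewrite invr_ge0 ltW.
Qed.

Lemma sum_tri_weight : \sum_a tri_weight a = 1.
Proof. by rewrite -mulr_suml mulfV// sum_inv_neq0. Qed.

Lemma sum3 (F : 'I_3 -> R) :
  \sum_i F i = F ord0 + F (lift ord0 ord0) + F (lift ord0 (lift ord0 ord0)).
Proof. by rewrite !big_ord_recl big_ord0 addr0 addrA. Qed.

Lemma ord3P (P : 'I_3 -> Prop) : P ord0 -> P (lift ord0 ord0) ->
  P (lift ord0 (lift ord0 ord0)) -> forall i, P i.
Proof.
move=> P0 P1 P2 [[|[|[|//]]] i3].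
- by rewrite (_ : Ordinal _ = ord0)//; exact/val_inj.
- by rewrite (_ : Ordinal _ = lift ord0 ord0)//; exact/val_inj.
- by rewrite (_ : Ordinal _ = lift ord0 (lift ord0 ord0))//; exact/val_inj.
Qed.

Lemma tri_lenE g : tri_len g = \sum_i z i - z g.
Proof. by rewrite (bigD1 g)//= addrC addrK. Qed.

(** On the side a, the coordinate a rises by [tri_len a], and the other two
    fall by z of each other, which is [tri_len a] in total. *)
Lemma sum_tri_coord a s : \sum_g tri_len g * tri_coord a g s = \sum_i z i.
Proof.
have len g : tri_len g != 0 by rewrite gt_eqF// tri_len_gt0.
move: (len ord0) (len (lift ord0 ord0)) (len (lift ord0 (lift ord0 ord0))).
rewrite sum3 /tri_coord; move: a; apply: ord3P;
rewrite !tri_lenE !sum3 -!val_eqE /=.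
all: set x := z ord0; set y := z (lift ord0 ord0);
  set t := z (lift ord0 (lift ord0 ord0)).
all: move=> h1 h2 h3; rewrite ?tri_lenE ?sum3 -/x -/y -/t; field.
all: by rewrite ?h1 ?h2 ?h3.
Qed.

Lemma tri_coord01 a g s : 0 <= s <= 1 -> 0 <= tri_coord a g s <= 1.
Proof.
move=> /andP[s0 s1]; rewrite /tri_coord; case: eqVneq => [_|ga].
  by rewrite s0.
have l0 := tri_len_gt0 g.
have zl : z a <= tri_len g.
  rewrite /tri_len (bigD1 a) 1?eq_sym//= lerDl sumr_ge0// => i _; exact: ltW.
have t0 : 0 <= (tri_len g - z a) / tri_len g.
  by rewrite divr_ge0 ?subr_ge0// ltW.
have t1 : (tri_len g - z a) / tri_len g <= 1.
  by rewrite ler_pdivrMr// mul1r gerBl ltW.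
by case: ifP => _; apply/andP; split; nra.
Qed.

(** Each coordinate is uniform: it runs through [0, 1] upwards on its own
    side, and downwards on the union of the other two sides, which it cuts in
    proportion to their weights. *)
Lemma tri_tail g y : 0 <= y <= 1 ->
  \sum_a tri_weight a *
    fine (uniform_prob (@ltr01 R) [set s | y <= tri_coord a g s]) = 1 - y.
Proof.
move=> y01.
suff : \sum_a (z a)^-1 *
    fine (uniform_prob (@ltr01 R) [set s | y <= tri_coord a g s]) =
    (\sum_a (z a)^-1) * (1 - y).
  move=> E; apply: (mulfI sum_inv_neq0); rewrite -E mulr_sumr.
  apply: eq_bigr => a _; rewrite /tri_weight mulrA; congr (_ * _).
  by rewrite mulrC divfK// sum_inv_neq0.
have E0 : fine (uniform_prob (@ltr01 R) [set s | y <= s]) = 1 - y.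
  rewrite (_ : [set s | _] = `[y, +oo[%classic) ?uniform_prob_ge//.
  by apply/seteqP; split=> s /=; rewrite in_itv/= andbT.
have ft i j := @folded_uniform_tail R (z i)^-1 (z j)^-1 y.
have zi i : 0 < (z i)^-1 by rewrite invr_gt0.
move: (z0 ord0) (z0 (lift ord0 ord0)) (z0 (lift ord0 (lift ord0 ord0))).
rewrite !sum3 /tri_coord; move: g; apply: ord3P;
rewrite !tri_lenE !sum3 -!val_eqE /= E0 => h0 h1 h2.
all: move: h0 h1 h2; rewrite ?tri_lenE ?sum3.
- have := ft (lift ord0 (lift ord0 ord0)) (lift ord0 ord0) (zi _) (zi _) y01.
  set x := z ord0; set u := z (lift ord0 ord0).
  set t := z (lift ord0 (lift ord0 ord0)).
  move=> E h0 h1 h2; move: E.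
  have -> : t^-1 / (t^-1 + u^-1) = (x + u + t - x - t) / (x + u + t - x).
    by field; repeat (apply/andP; split); apply: lt0r_neq0; lra.
  have -> : u^-1 / (t^-1 + u^-1) = (x + u + t - x - u) / (x + u + t - x).
    by field; repeat (apply/andP; split); apply: lt0r_neq0; lra.
  by lra.
- have := ft ord0 (lift ord0 (lift ord0 ord0)) (zi _) (zi _) y01.
  set x := z ord0; set u := z (lift ord0 ord0).
  set t := z (lift ord0 (lift ord0 ord0)).
  move=> E h0 h1 h2; move: E.
  have -> : x^-1 / (x^-1 + t^-1) = (x + u + t - u - x) / (x + u + t - u).
    by field; repeat (apply/andP; split); apply: lt0r_neq0; lra.
  have -> : t^-1 / (x^-1 + t^-1) = (x + u + t - u - t) / (x + u + t - u).
    by field; repeat (apply/andP; split); apply: lt0r_neq0; lra.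
  by lra.
- have := ft (lift ord0 ord0) ord0 (zi _) (zi _) y01.
  set x := z ord0; set u := z (lift ord0 ord0).
  set t := z (lift ord0 (lift ord0 ord0)).
  move=> E h0 h1 h2; move: E.
  have -> : u^-1 / (u^-1 + x^-1) = (x + u + t - t - u) / (x + u + t - t).
    by field; repeat (apply/andP; split); apply: lt0r_neq0; lra.
  have -> : x^-1 / (u^-1 + x^-1) = (x + u + t - t - x) / (x + u + t - t).
    by field; repeat (apply/andP; split); apply: lt0r_neq0; lra.
  by lra.
Qed.

Lemma measurable_tri_coord a g y : measurable [set s | y <= tri_coord a g s].
Proof.
rewrite /tri_coord; case: eqVneq => [_|_].
  rewrite (_ : [set s | _] = `[y, +oo[%classic)//.
  by apply/seteqP; split=> s /=; rewrite in_itv/= andbT.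
have mf (f : R -> R) : measurable_fun setT f -> measurable [set s | y <= f s].
  move=> mf.
  have -> : [set s | y <= f s] = setT `&` f @^-1` `[y, +oo[%classic.
    by rewrite setTI; apply/seteqP; split=> s /=; rewrite in_itv/= andbT.
  exact: mf.
case: (val g == ((val a).+1 %% 3)%N); apply: mf.
  by apply: measurable_funM => //; apply: measurable_funB.
by apply: measurable_funB => //; apply: measurable_funM.
Qed.

End triangle.

(** * Coupling finitely many discrete uniform variables *)

Definition grid (K n : nat) := {ffun 'I_K -> 'I_n.+1}.

Definition marginal (R : realType) (K n : nat) (p : grid K n -> R)
  (k : 'I_K) (j : nat) : R := \sum_(x : grid K n | x k == j :> nat) p x.

(** The members of a group share one uniform position u, and the uniform
    variable on {0, ..., l} is the integer part of (l + 1) u, which is at least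
    l u - 1.  The three lengths are enlarged by 2, which makes the parameters z
    of the triangle positive even when a triangle inequality is an equality.
    The rounding costs K, and the enlargement costs 3. *)
Lemma coupled_uniforms (R : realType) (K n L : nat) (l : 'I_K -> nat)
    (g : 'I_K -> 'I_3) :
  (forall k, l k <= n)%N ->
  (forall i, \sum_(k | g k == i) l k <= L)%N ->
  (\sum_k l k = L.*2)%N ->
  exists p : grid K n -> R, [/\ forall x, 0 <= p x,
    forall x, p x != 0 -> (L <= \sum_k x k + (K + 3))%N &
    forall k j, marginal p k j = if (j <= l k)%N then (l k).+1%:R^-1 else 0].
Proof.
move=> ln SL SE.
pose S i := (\sum_(k | g k == i) l k)%N.
pose z (i : 'I_3) : R := (L - S i)%:R + 1.
have z0 i : 0 < z i by rewrite ltr_wpDl.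
have sumS : (\sum_i S i = L.*2)%N.
  by rewrite -SE [RHS](partition_big g predT).
have zE i : z i = L%:R - (S i)%:R + 1 by rewrite /z natrB// SL.
have sumz : \sum_i z i = L%:R + 3.
  under eq_bigr do rewrite zE.
  rewrite big_split/= big_split/= sumrN !sumr_const card_ord -natr_sum sumS.
  by rewrite -[_ *+ 3]mulr_natr -addnn natrD; ring.
have lenE i : tri_len z i = (S i)%:R + 2.
  by rewrite tri_lenE sumz zE; ring.
pose u a k s := tri_coord z a (g k) s.
pose y a k s := minn (l k) (Num.trunc ((l k).+1%:R * u a k s)).
pose Y a s : grid K n := [ffun k => inord (y a k s)].
have Yy a s k : Y a s k = y a k s :> nat.
  by rewrite ffunE inordK// ltnS (leq_trans (geq_minl _ _)).
have lge a k j : [set s | (j <= y a k s)%N] =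
    if j == 0 then setT else if (l k < j)%N then set0 else
    [set s | (j%:R / (l k).+1%:R : R) <= u a k s].
  case: j => [|j]; first by apply/seteqP; split.
  apply/seteqP; split=> s /=; rewrite leq_min truncn_gt_nat.
    move=> /andP[jl H]; rewrite ltnNge jl/=.
    by rewrite ler_pdivrMr// mulrC.
  case: ltnP => //= jl.
  by rewrite ler_pdivrMr// mulrC.
have mge a k j : measurable [set s | (j <= y a k s)%N].
  rewrite lge; case: ifP => _ //; case: ifP => _ //.
  exact: measurable_tri_coord.
have mY a x : measurable (Y a @^-1` [set x]).
  rewrite (_ : _ @^-1` _ = \bigcap_(k in setT)
    ([set s | (x k <= y a k s)%N] `\` [set s | (x k < y a k s)%N])).
    apply: fin_bigcap_measurable => [|k _]; first exact: finite_finset.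
    exact: measurableD.
  apply/seteqP; split=> s /=.
    by move=> <- k _ /=; rewrite Yy ltnn; split.
  move=> H; apply/ffunP => k; apply/val_inj;
    rewrite -[LHS]/(nat_of_ord (Y a s k)) Yy.
  have [/= h1 /negP] := H k I; rewrite -leqNgt => h2.
  by apply/eqP; rewrite eqn_leq h1 h2.
exists (fun x => \sum_a tri_weight z a *
  fine (uniform_prob (@ltr01 R) (Y a @^-1` [set x]))); split.
- move=> x; apply: sumr_ge0 => a _; apply: mulr_ge0.
    exact: tri_weight_ge0.
  by rewrite fine_ge0.
- move=> x px.
  have [a na] : exists a, uniform_prob (@ltr01 R) (Y a @^-1` [set x]) != 0%E.
    apply/existsP; apply: contraNT px; rewrite negb_exists => /forallP H.
    rewrite big1// => a _; have := H a; rewrite negbK => /eqP ->.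
    by rewrite mulr0.
  have [s s01 Ys] : exists2 s : R, 0 <= s <= 1 & Y a s = x.
    apply: contrapT => H; move/eqP: na; apply.
    rewrite uniform_prob_itv// (_ : _ `&` _ = set0) ?measure0//.
    apply/seteqP; split=> s //= [h1]; rewrite in_itv/= => h2.
    by apply: H; exists s.
  have u01 k : 0 <= u a k s <= 1 by apply: tri_coord01.
  have xk k : (l k)%:R * u a k s - 1 <= (x k)%:R.
    rewrite -Ys Yy /y; have /andP[h1 h2] := u01 k.
    have h3 : (0 : R) <= (l k)%:R by [].
    have [H|H] := leqP (l k) (Num.trunc ((l k).+1%:R * u a k s)); first by nra.
    have := truncnS_gt ((l k).+1%:R * u a k s).
    by rewrite -![in _.+1%:R]natr1; nra.
  have : \sum_k ((l k)%:R * u a k s - 1) <= (\sum_k x k)%:R.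
    by rewrite natr_sum; apply: ler_sum.
  rewrite big_split/= sumr_const card_ord.
  have -> : \sum_k (l k)%:R * u a k s =
      \sum_i (S i)%:R * tri_coord z a i s.
    rewrite (partition_big g predT)//=; apply: eq_bigr => i _.
    rewrite natr_sum mulr_suml; apply: eq_bigr => k /eqP <- //.
  have -> : \sum_i (S i)%:R * tri_coord z a i s =
      \sum_i (tri_len z i * tri_coord z a i s - 2 * tri_coord z a i s).
    by apply: eq_bigr => i _; rewrite lenE; ring.
  rewrite big_split/= sum_tri_coord// sumz sumrN.
  have : \sum_i 2 * tri_coord z a i s <= \sum_(i < 3) 2.
    apply: ler_sum => i _; have /andP[_] := tri_coord01 z0 a i s01.
    by move=> ?; lra.
  rewrite sumr_const card_ord -(ler_nat R) !natrD => h1 h2.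
  rewrite -(mulr_natr 2) in h1; rewrite -(mulr_natr (-1)) in h2; lra.
- have tail k j : (j <= (l k).+1)%N ->
    \sum_(x : grid K n | (j <= x k)%N) \sum_a tri_weight z a *
    fine (uniform_prob (@ltr01 R) (Y a @^-1` [set x])) =
    1 - j%:R / (l k).+1%:R.
    move=> jl; rewrite exchange_big/=.
    have fib a : \sum_(x : grid K n | (j <= x k)%N)
        fine (uniform_prob (@ltr01 R) (Y a @^-1` [set x])) =
        fine (uniform_prob (@ltr01 R) [set s | (j <= y a k s)%N]).
      have := @sum_fibers _ _ _ (uniform_prob (@ltr01 R)) _ (Y a)
        (fun x : grid K n => (j <= x k)%N) (mY a).
      move=> ->; congr (fine (_ _)).
      by apply/seteqP; split=> s /=; rewrite Yy.
    under eq_bigr do rewrite -mulr_sumr fib lge.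
    have [->|j0] := eqVneq j 0.
      under eq_bigr do rewrite probability_setT mulr1.
      by rewrite sum_tri_weight// mul0r subr0.
    have [lj|lj] := ltnP (l k) j.
      under eq_bigr do rewrite measure0 mulr0.
      have -> : j = (l k).+1 by apply/eqP; rewrite eqn_leq jl lj.
      by rewrite divff ?subrr// big1.
    rewrite tri_tail// divr_ge0//= ler_pdivrMr// mul1r ler_nat.
    by rewrite (leq_trans lj).
  move=> k j; rewrite /marginal; case: ifPn => [jl|].
    have := tail k j (leq_trans jl (leqnSn _)).
    rewrite (bigID (fun x : grid K n => x k == j :> nat))/=.
    rewrite (eq_bigl (fun x : grid K n => x k == j :> nat)); last first.
      by move=> x; case: eqVneq => [->|]; rewrite ?leqnn ?andbF.
    rewrite [X in _ + X](eq_bigl (fun x : grid K n => j < x k)%N); last first.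
      by move=> x; rewrite ltn_neqAle eq_sym andbC.
    rewrite tail// -(natr1 j) => E.
    have l0 : (l k).+1%:R != 0 :> R by rewrite pnatr_eq0.
    by rewrite -(addrK (1 - (j%:R + 1) / (l k).+1%:R) (\sum_(x | _) _)) E;
      field.
  rewrite -ltnNge => lj; apply: big1 => x /eqP xj.
  have := tail k _ (leqnn _); rewrite divff ?pnatr_eq0// subrr.
  move=> /psumr_eq0P; apply; last by rewrite xj.
  move=> x' _; apply: sumr_ge0 => a _; apply: mulr_ge0;
    last by rewrite fine_ge0.
  exact: tri_weight_ge0.
Qed.

Lemma trim_sum (I : finType) (Q : pred I) (c : I -> nat) (s : nat) :
  (s <= \sum_(i | Q i) c i)%N ->
  exists2 l : I -> nat, forall i, (l i <= c i)%N & (\sum_(i | Q i) l i = s)%N.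
Proof.
elim: s => [|s IH] sc; first by exists (fun=> 0%N); rewrite ?big1.
have [l lc ls] := IH (ltnW sc).
have [i Qi li] : exists2 i, Q i & (l i < c i)%N.
  apply: contrapT => H; move: sc; rewrite -ls ltnNge => /negP; apply.
  apply: leq_sum => i Qi; rewrite leqNgt; apply/negP => li.
  by apply: H; exists i.
exists (fun j => if j == i then (l j).+1 else l j).
  by move=> j; case: eqVneq => [->|].
rewrite (bigD1 i)//= eqxx addSn -ls [in RHS](bigD1 i)//=; congr ((_ + _).+1)%N.
by apply: eq_bigr => j /andP[_ /negbTE ->].
Qed.

(** The groups are the indices before, at and after the place where the
    partial sums of c exceed L = sum c - n.  Full lengths in the first group
    are then at most L in total; the second group has one member, cut at L; the
    third one is trimmed so as to reach the total 2L.  There is enough room for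
    that because L <= n and c_k <= n. *)
Lemma choose_lengths (K n : nat) (c : 'I_K -> nat) : (0 < n)%N ->
  (forall k, c k <= n)%N -> (n <= \sum_k c k <= n.*2)%N ->
  exists (l : 'I_K -> nat) (g : 'I_K -> 'I_3), [/\ forall k, (l k <= c k)%N,
    forall i, (\sum_(k | g k == i) l k <= \sum_k c k - n)%N &
    (\sum_k l k = (\sum_k c k - n).*2)%N].
Proof.
move=> n0 cn /andP[nc c2n].
have K0 : (0 < K)%N.
  by move: nc; case: (K) c {cn c2n} => // c; rewrite big_ord0; lia.
set L := (\sum_k c k - n)%N.
pose pre i := (\sum_(k < K | k < i) c k)%N.
have preK : (L < pre K)%N.
  have -> : pre K = (\sum_k c k)%N by apply: eq_bigl => k; rewrite ltn_ord.
  by rewrite /L; lia.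
have exi : exists i, (L < pre i.+1)%N by exists K.-1; rewrite prednK.
case: (ex_minnP exi) => i Li imin.
have iK : (i < K)%N by rewrite -(prednK K0) ltnS imin// prednK.
have preL : (pre i <= L)%N.
  case: i Li imin {iK} => [|i] Li imin; first by rewrite /pre big_pred0.
  by rewrite leqNgt; apply/negP => /imin; rewrite ltnn.
pose i0 := Ordinal iK.
pose g (k : 'I_K) : 'I_3 := if (k < i)%N then ord0 else
  if k == i0 then lift ord0 ord0 else lift ord0 (lift ord0 ord0).
have sumg (F : 'I_K -> nat) : (\sum_k F k = \sum_(k | g k == ord0) F k + F i0 +
   \sum_(k | g k == lift ord0 (lift ord0 ord0)) F k)%N.
  rewrite (partition_big g predT)//= !big_ord_recl big_ord0 addn0 addnA.
  congr (_ + _ + _)%N; apply: big_pred1 => k; rewrite /g/=.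
  case: ltnP => ki; last by case: (k == i0).
  by symmetry; apply/negbTE; rewrite -val_eqE/= ltn_eqF.
have pg : pre i = (\sum_(k | g k == ord0) c k)%N.
  by apply: eq_bigl => k; rewrite /g; case: ltnP => // _; case: (k == i0).
have preS : (pre i.+1 = pre i + c i0)%N.
  rewrite /pre (bigD1 i0)//= addnC; congr (_ + _)%N; apply: eq_bigl => k.
  by rewrite ltnS ltn_neqAle andbC.
have cS := sumg c; rewrite -pg in cS.
have ci := cn i0.
pose rest := (\sum_(k | g k == lift ord0 (lift ord0 ord0)) c k)%N.
have restE : (L.*2 - pre i - minn (c i0) L <= rest)%N.
  by move: cS Li; rewrite preS -/rest /L; lia.
have [l lc ls] := trim_sum restE.
exists (fun k : 'I_K => if (k < i)%N then c k else if k == i0 then minn (c k) L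
  else l k).
exists g; split.
- move=> k; case: ifP => // _; case: ifP => // _; exact: geq_minl.
- apply: ord3P => /=.
  + rewrite (eq_bigr c) -?pg// => k; rewrite /g; case: ltnP => // _.
    by case: (k == i0).
  + rewrite (big_pred1 i0) ?ltnn ?eqxx ?geq_minr// => k; rewrite /g/=.
    case: ltnP => ki; last by case: (k == i0).
    by symmetry; apply/negbTE; rewrite -val_eqE/= ltn_eqF.
  + rewrite (eq_bigr l); last first.
      by move=> k; rewrite /g; case: ltnP => // _; case: (k == i0).
    by rewrite ls; move: cS Li; rewrite preS -/rest /L; lia.
- rewrite sumg (eq_bigr c); last first.
    by move=> k; rewrite /g; case: ltnP => // _; case: (k == i0).
  rewrite ltnn eqxx [X in (_ + X)%N](eq_bigr l); last first.
    by move=> k; rewrite /g; case: ltnP => // _; case: (k == i0).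
  by rewrite ls -pg; move: preL; lia.
Qed.

Lemma sum_interval (c l : nat) : (l <= c)%N ->
  (2 * \sum_(c - l <= j < c.+1) j = l.+1 * (c.*2 - l))%N.
Proof.
elim: l => [|l IH] lc; first by rewrite subn0 big_nat1; lia.
rewrite big_ltn; last by lia.
by rewrite -subnSK// in IH *; rewrite mulnDr IH; lia.
Qed.

Lemma marginal_sum (R : realType) (K n : nat) (p : grid K n -> R) k :
  \sum_(j < n.+1) marginal p k j = \sum_x p x.
Proof. by rewrite [RHS](partition_big (fun x : grid K n => x k) predT). Qed.

Lemma marginal_ge0 (R : realType) (K n : nat) (p : grid K n -> R) k j :
  (forall x, 0 <= p x) -> 0 <= marginal p k j.
Proof. by move=> p0; apply: sumr_ge0. Qed.

Lemma marginal_le_sum (R : realType) (K n : nat) (p : grid K n -> R) k j :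
  (forall x, 0 <= p x) -> marginal p k j <= \sum_x p x.
Proof.
move=> p0; rewrite /marginal [leRHS](bigID (fun x : grid K n => x k == j :>
  nat))/=.
by rewrite lerDl; apply: sumr_ge0.
Qed.

(** The coupling of [coupled_uniforms] is reflected by x_k = c_k - y_k, which
    turns the lower bound on the sum of the y_k into an upper bound.  The mean
    of the sum is sum c - L = n. *)
Lemma coupled_blocks (R : realType) (K n : nat) (c : 'I_K -> nat) : (0 < n)%N ->
  (forall k, c k <= n)%N -> (n <= \sum_k c k <= n.*2)%N ->
  exists p : grid K n -> R, [/\ forall x, 0 <= p x,
    forall x, p x != 0 -> (\sum_k x k <= n + (K + 3))%N,
    \sum_x p x = 1,
    forall k j, j != c k -> marginal p k j <= marginal p k j.+1 &
    n%:R <= \sum_k \sum_(j < n.+1) j%:R * marginal p k j].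
Proof.
move=> n0 cn csum; have [l [g [lc gL lsum]]] := choose_lengths n0 cn csum.
have ln k : (l k <= n)%N := leq_trans (lc k) (cn k).
have [q [q0 qL qm]] := @coupled_uniforms R K n _ l g ln gL lsum.
(* A coordinate above c k carries no mass; leaving it alone makes phi an
   involution of the whole grid. *)
pose phi (x : grid K n) : grid K n :=
  [ffun k => if (x k <= c k)%N then inord (c k - x k) else x k].
have phiE x k : phi x k = (if x k <= c k then c k - x k else x k)%N :> nat.
  rewrite ffunE; case: ifP => // _; rewrite inordK// ltnS.
  by rewrite (leq_trans (leq_subr _ _)).
have phiK : involutive phi.
  move=> x; apply/ffunP => k; apply/val_inj.
  rewrite -[LHS]/(nat_of_ord (phi (phi x) k)) !phiE.
  case: (leqP (x k) (c k)) => h; first by rewrite leq_subr subKn.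
  by rewrite leqNgt h.
have ql x k : q x != 0 -> (x k <= l k)%N.
  move=> qx; rewrite leqNgt; apply/negP => lx.
  have := qm k (x k); rewrite leqNgt lx/= => /psumr_eq0P H.
  by move/eqP: qx; apply; apply: H.
pose p x := q (phi x).
have pm k j : marginal p k j =
    if (c k - l k <= j <= c k)%N then (l k).+1%:R^-1 else 0.
  rewrite /marginal (reindex_inj (inv_inj phiK))/=.
  under eq_bigr do rewrite /p phiK.
  have [jc|jc] := leqP j (c k); last first.
    rewrite andbF; apply: big1 => x /eqP xj;
      apply/eqP/negPn/negP => /(ql _ k) xl.
    have := lc k; move: xj; rewrite phiE; case: ifP => _; lia.
  have := qm k (c k - j)%N;
    rewrite (_ : (c k - j <= l k)%N = (c k - l k <= j)%N);
    last by have := lc k; lia.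
  rewrite andbT => <-; apply: eq_bigl => x; rewrite phiE.
  by case: (leqP (x k) (c k)) => h; apply/eqP/eqP; lia.
have psum : \sum_x p x = 1.
  rewrite /p (reindex_inj (inv_inj phiK))/=.
  under eq_bigr do rewrite phiK.
  have [k _] : exists k : 'I_K, true.
    case: (K) c cn csum {l g lc gL lsum ln q q0 qL qm phi phiE phiK ql p pm} =>
      [|K'] c.
      by rewrite big_ord0; lia.
    by exists ord0.
  rewrite -(marginal_sum q k); under eq_bigr do rewrite qm.
  rewrite -big_mkcond/= -(@big_ord_widen _ 0 +%R (l k).+1 n.+1 (fun=> (l
    k).+1%:R^-1)) ?ltnS//.
  by rewrite sumr_const card_ord -[LHS]mulr_natl divff ?pnatr_eq0.
exists p; split => //.
- by move=> x; apply: q0.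
- move=> x px; have := qL _ px.
  have xc k : (phi x k <= c k)%N := leq_trans (ql _ k px) (lc k).
  have E : (\sum_k phi x k + \sum_k x k = \sum_k c k)%N.
    rewrite -big_split/=; apply: eq_bigr => k _; have := xc k; rewrite phiE.
    by case: ifP; lia.
  by move: csum; lia.
- move=> k j jc; rewrite !pm.
  have [h1|h1] := boolP (c k - l k <= j <= c k)%N.
    by rewrite (_ : _ && _)//; have := lc k; lia.
  by case: ifP => // _; rewrite invr_ge0.
- have E k : 2 * \sum_(j < n.+1) j%:R * marginal p k j =
      (c k).*2%:R - (l k)%:R.
    under eq_bigr do rewrite pm mulrC (fun_if ( *%R^~ _)) mul0r.
    rewrite -big_mkcond/= -mulr_sumr.
    have -> : \sum_(i < n.+1 | (c k - l k <= i <= c k)%N) (i%:R : R) =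
        (\sum_(c k - l k <= j < (c k).+1) j)%:R.
      rewrite natr_sum (@big_nat_widen _ _ _ _ _ n.+1) ?ltnS//.
      rewrite (@big_nat_widenl _ _ _ _ 0)// big_mkord.
      by apply: eq_bigl => j; rewrite ltnS/= andbC.
    have /(congr1 (fun m => m%:R : R)) := sum_interval (lc k).
    rewrite !natrM mulrCA => ->.
    rewrite mulKf ?pnatr_eq0// natrB//.
    by have := lc k; lia.
  rewrite -(ler_pM2l (_ : 0 < 2 :> R))// mulr_sumr.
  under eq_bigr do rewrite E.
  have S2 : (\sum_k (c k).*2 = (\sum_k c k).*2)%N.
    by rewrite (big_morph _ doubleD double0).
  rewrite big_split/= sumrN -!natr_sum lsum S2 lerBrDr -natrM -natrD ler_nat.
  by lia.
Qed.

(** * Drop points of decreasing mass functions *)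

(** Replace the a_k by the b_k one at a time and stop as soon as the sum
    reaches n. *)
Lemma select_sum (K n : nat) (a b : 'I_K -> nat) :
  (forall k, b k <= n)%N -> (\sum_k a k <= n.*2)%N -> (n <= \sum_k b k)%N ->
  exists2 c : 'I_K -> nat, forall k, c k = a k \/ c k = b k &
    (n <= \sum_k c k <= n.*2)%N.
Proof.
move=> bn an nb.
pose c i (k : 'I_K) := if (k < i)%N then b k else a k.
have cab i k : c i k = a k \/ c i k = b k.
  by rewrite /c; case: ifP; [right|left].
have exi : exists i, (n <= \sum_k c i k)%N.
  exists K; rewrite (eq_bigr b)// => k _; by rewrite /c ltn_ord.
case: (ex_minnP exi) => -[|i] ni imin.
  exists (c 0%N) => //; rewrite ni/= (eq_bigr a)// => k _.
exists (c i.+1) => //; rewrite ni/=.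
have Si : (\sum_k c i k < n)%N by rewrite ltnNge; apply/negP => /imin;
  rewrite ltnn.
suff le : (\sum_k c i.+1 k <= \sum_k c i k + n)%N.
  by rewrite (leq_trans le)// -addnn leq_add2r ltnW.
have [iK|iK] := ltnP i K; last first.
  rewrite (eq_bigr (c i)) ?leq_addr// => k _; rewrite /c.
  by rewrite !(leq_trans (ltn_ord k))// (leq_trans iK).
rewrite (bigD1 (Ordinal iK))//= [in leqRHS](bigD1 (Ordinal iK))//=.
rewrite (eq_bigr (c i)) => [|k ki].
  have -> : c i.+1 (Ordinal iK) = b (Ordinal iK) by rewrite /c/= ltnSn.
  by rewrite [leqRHS]addnAC leq_add2r (leq_trans (bn _))// leq_addl.
rewrite /c ltnS leq_eqVlt (_ : (nat_of_ord k == i) = false)//.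
by apply: negbTE; move: ki; rewrite -val_eqE.
Qed.

Lemma sum_shift0 (R : realType) (a : nat) :
  \sum_(j < a.+1) (2 * j%:R - a%:R : R) = 0.
Proof.
rewrite big_split/= -mulr_sumr sumr_const card_ord.
rewrite -(big_mkord xpredT (fun j => j%:R : R)) -natr_sum.
have := sum_interval (leqnn a); rewrite subnn => /(congr1 (fun m => m%:R : R)).
rewrite !natrM => ->; rewrite -mulr_natl.
by rewrite (_ : a.*2 - a = a)%N; [ring|lia].
Qed.

Section decreasing.
Variables (R : realType) (n : nat) (g : nat -> R).
Hypothesis gdec : forall j, g j.+1 <= g j.
Hypothesis gn : forall j, (n < j)%N -> g j = 0.
Let M := \sum_(j < n.+1) g j.
Let mean := \sum_(j < n.+1) j%:R * g j.

Lemma decr_le i j : (i <= j)%N -> g j <= g i.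
Proof.
elim: j => [|j IH]; first by rewrite leqn0 => /eqP ->.
rewrite leq_eqVlt => /predU1P[->//|ij]; exact: le_trans (gdec j) (IH ij).
Qed.

Lemma decr_ge0 j : 0 <= g j.
Proof. by rewrite -(@gn (n.+1 + j)) ?leq_addr// decr_le// leq_addl. Qed.

(** The last drop b is the right end of the support, whence the bound on the
    mean. *)
Lemma last_drop : 0 < M -> exists b, [/\ g b.+1 < g b, (b <= n)%N,
  forall j, (b < j)%N -> g j = 0 & mean <= b%:R * M].
Proof.
move=> M0.
have exb : exists j, 0 < g j.
  apply: contrapT => H; move: M0; rewrite /M big1 ?ltxx// => j _.
  apply/eqP; rewrite eq_le decr_ge0 andbT leNgt; apply/negP => gj.
  by apply: H; exists j.
have bd j : 0 < g j -> (j <= n)%N.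
  by move=> gj; rewrite leqNgt; apply/negP => /gn E; rewrite E ltxx in gj.
case: (ex_maxnP exb bd) => b b0 bmax.
have bz j : (b < j)%N -> g j = 0.
  move=> bj; apply/eqP; rewrite eq_le decr_ge0 andbT leNgt; apply/negP => gj.
  by have := bmax _ gj; lia.
exists b; split => //; [by rewrite bz|exact: bd|].
rewrite /mean /M mulr_sumr; apply: ler_sum => j _.
have [jb|jb] := leqP j b; last by rewrite bz// !mulr0.
by rewrite ler_wpM2r ?decr_ge0 ?ler_nat.
Qed.

(** Up to its first drop g is constant, so that the mean of this part is
    a / 2 times its mass, and the remaining mass is further to the right. *)
Lemma first_drop : 0 < M -> exists a, [/\ g a.+1 < g a, (a <= n)%N &
   a%:R * M <= 2 * mean].
Proof.
move=> M0; have [b [bd bn _ _]] := last_drop M0.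
have exa : exists a, g a.+1 < g a by exists b.
case: (ex_minnP exa) => a ad amin.
have an : (a <= n)%N by rewrite (leq_trans (amin _ bd)).
have ga j : (j <= a)%N -> g j = g 0%N.
  elim: j => // j IH ja; rewrite -(IH (ltnW ja)); apply/eqP.
  rewrite eq_le gdec leNgt; apply/negP => /amin; lia.
exists a; split => //.
rewrite -subr_ge0 /M /mean !mulr_sumr -sumrB.
have E : g 0%N * \sum_(j < a.+1) (2 * j%:R - a%:R : R) = 0.
  by rewrite sum_shift0 mulr0.
rewrite -[leLHS]E {E}.
rewrite (@big_ord_widen _ 0 +%R a.+1 n.+1 (fun j => 2 * j%:R - a%:R)) ?ltnS//.
rewrite big_mkcond mulr_sumr. apply: ler_sum => j _; rewrite ltnS.
case: leqP => ja; first by rewrite ga//; lra.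
rewrite mulr0 mulrA -mulrBl mulr_ge0 ?decr_ge0// subr_ge0.
by rewrite -natrM ler_nat; lia.
Qed.

End decreasing.

(** * Joint mixability of decreasing mass functions *)

Lemma common_positive_bound (R : realType) (K : nat) (d : 'I_K -> R) (M : R) :
  0 < M -> (forall k, 0 < d k) ->
  exists e, [/\ 0 < e, e <= M & forall k, e <= d k].
Proof.
move=> M0 d0; exists (\big[Num.min/M]_k d k); split.
- by apply: lt_bigmin.
- exact: bigmin_le_id.
- by move=> k; exact: bigmin_le.
Qed.

Lemma marginal_scale (R : realType) (K n : nat) (e : R) (p : grid K n -> R)
    k j :
  marginal (fun x => e * p x) k j = e * marginal p k j.
Proof. by rewrite /marginal mulr_sumr. Qed.

Lemma marginal_add (R : realType) (K n : nat) (p q : grid K n -> R) k j :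
  marginal (fun x => p x + q x) k j = marginal p k j + marginal q k j.
Proof. by rewrite /marginal big_split. Qed.

Lemma marginal_out (R : realType) (K n : nat) (p : grid K n -> R) k j :
  (n < j)%N -> marginal p k j = 0.
Proof.
move=> nj; apply: big_pred0 => x; apply/negbTE.
by rewrite neq_ltn (leq_ltn_trans _ nj)// -ltnS.
Qed.

(** A small multiple of a coupling of laws which are nondecreasing up to a
    drop point of g k, and vanish after it, can be subtracted from g.  If the
    last drops have a sum at most n, the coupling is the point mass at these
    drops, and the mean invariant persists because the supports do not grow;
    otherwise it comes from [coupled_blocks], whose mean is n. *)
Lemma extend_coupling (R : realType) (K n : nat) (g : 'I_K -> nat -> R)
    (M : R) :
  (0 < n)%N -> (forall k j, g k j.+1 <= g k j) ->
  (forall k j, (n < j)%N -> g k j = 0) ->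
  (forall k, \sum_(j < n.+1) g k j = M) -> 0 < M ->
  \sum_k \sum_(j < n.+1) j%:R * g k j <= n%:R * M ->
  exists p : grid K n -> R, [/\ forall x, 0 <= p x,
    forall x, p x != 0 -> (\sum_k x k <= n + (K + 3))%N,
    0 < \sum_x p x,
    forall k j, g k j.+1 - marginal p k j.+1 <= g k j - marginal p k j &
    \sum_k \sum_(j < n.+1) j%:R * (g k j - marginal p k j) <=
    n%:R * (M - \sum_x p x)].
Proof.
move=> n0 gdec gn gM M0 gmean.
suff [c [q [cd q0 qs q1 [qm qmean]]]] :
    exists (c : 'I_K -> nat) (q : grid K n -> R),
    [/\ forall k, g k (c k).+1 < g k (c k), forall x, 0 <= q x,
      forall x, q x != 0 -> (\sum_k x k <= n + (K + 3))%N,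
      \sum_x q x = 1 &
      (forall k j, j != c k -> marginal q k j <= marginal q k j.+1) /\
      (forall e, 0 < e -> e <= M ->
        \sum_k \sum_(j < n.+1) j%:R * (g k j - e * marginal q k j) <=
        n%:R * (M - e))].
  have [e [e0 eM ed]] := common_positive_bound M0 (fun k => etrans (subr_gt0 _
    _) (cd k)).
  exists (fun x => e * q x); split.
  - by move=> x; rewrite mulr_ge0// ltW.
  - by move=> x; rewrite mulf_eq0 negb_or => /andP[_ /qs].
  - by rewrite -mulr_sumr q1 mulr1.
  - move=> k j; rewrite !marginal_scale.
    have [->|jc] := eqVneq j (c k).
      have := marginal_ge0 k (c k).+1 q0; have := marginal_le_sum k (c k) q0.
      have := ed k; rewrite q1; nra.
    by have := qm _ _ jc; have := gdec k j; nra.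
  - rewrite -mulr_sumr q1 mulr1; apply: le_trans (qmean _ e0 eM).
    by apply: ler_sum => k _; apply: ler_sum => j _; rewrite marginal_scale.
have Mk k : 0 < \sum_(j < n.+1) g k j by rewrite gM.
have /fin_all_exists[b bP] k := last_drop (gdec k) (gn k) (Mk k).
have /fin_all_exists[a aP] k := first_drop (gdec k) (gn k) (Mk k).
have bn k : (b k <= n)%N by case: (bP k).
have [bs|bs] := leqP (\sum_k b k) n.
  pose x0 : grid K n := [ffun k => inord (b k)].
  have x0E k : x0 k = b k :> nat by rewrite ffunE inordK ?ltnS.
  have m0 k j : marginal (fun x => (x == x0)%:R : R) k j = (j == b k)%:R.
    rewrite /marginal; have [->|jb] := eqVneq j (b k).
      rewrite (bigD1 x0) ?x0E//= eqxx big1 ?addr0// => x /andP[_ /negbTE ->//].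
    by apply: big1 => x /eqP xj; case: eqVneq => // xx; move: jb;
      rewrite -xj xx x0E eqxx.
  exists b, (fun x => (x == x0)%:R); split; last split.
  - by move=> k; case: (bP k).
  - by move=> x; rewrite ler0n.
  - move=> x /=; case: (eqVneq x x0) => [->|_]; last by rewrite eqxx.
    by rewrite (eq_bigr b) => [|k _]; [lia|rewrite x0E].
  - by rewrite (bigD1 x0)//= eqxx big1 ?addr0// => x /negbTE ->.
  - by move=> k j jb; rewrite !m0 (negbTE jb) ler0n.
  - move=> e e0 eM.
    have E k : \sum_(j < n.+1) j%:R * (g k j - e * marginal (fun x => (x ==
      x0)%:R) k j)
       <= (b k)%:R * (M - e).
      under eq_bigr do rewrite mulrBr m0.
      rewrite sumrB mulrBr lerB//; first by rewrite -(gM k); case: (bP k).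
      rewrite (bigD1 (inord (b k)))//= inordK ?ltnS// eqxx mulr1 lerDl.
      by apply: sumr_ge0 => j _; rewrite !mulr_ge0// ltW.
    apply: le_trans (ler_sum _ (fun k _ => E k)) _.
    by rewrite -mulr_suml -natr_sum ler_wpM2r ?subr_ge0// ler_nat.
have as2 : (\sum_k a k <= n.*2)%N.
  rewrite -(ler_nat R) -(ler_pM2r M0) natr_sum mulr_suml.
  rewrite -muln2 natrM mulrAC [leRHS]mulrC;
    apply: le_trans (ler_wpM2l _ gmean) => //.
  by rewrite mulr_sumr; apply: ler_sum => k _; rewrite -(gM k); case: (aP k).
have [c cab csum] := select_sum bn as2 (ltnW bs).
have cd k : g k (c k).+1 < g k (c k).
  by case: (cab k) => ->; [case: (aP k)|case: (bP k)].
have cn k : (c k <= n)%N by case: (cab k) => ->; [case: (aP k)|case: (bP k)].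
have [q [q0 qs q1 qm qmean]] := coupled_blocks R n0 cn csum.
exists c, q; split => //; split => // e e0 eM.
under eq_bigr do [under eq_bigr do rewrite mulrBr mulrCA;
  rewrite sumrB -mulr_sumr].
rewrite sumrB -mulr_sumr mulrBr lerB// mulrC ler_wpM2l// ltW//.
Qed.

(** The maximum is taken over all partial couplings p whose remainder
    f - marginal p is decreasing and satisfies the mean invariant.  If it had
    mass less than 1, [extend_coupling] would apply to the remainder. *)
Theorem joint_mix (R : realType) (K n : nat) (f : 'I_K -> nat -> R) :
  (0 < n)%N -> (0 < K)%N -> (forall k j, f k j.+1 <= f k j) ->
  (forall k j, (n < j)%N -> f k j = 0) ->
  (forall k, \sum_(j < n.+1) f k j = 1) ->
  \sum_k \sum_(j < n.+1) j%:R * f k j <= n%:R ->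
  exists p : grid K n -> R, [/\ forall x, 0 <= p x,
    forall x, p x != 0 -> (\sum_k x k <= n + (K + 3))%N &
    forall k j, marginal p k j = f k j].
Proof.
move=> n0 K0 fdec fn f1 fmean.
pose rem (p : grid K n -> R) k j := f k j - marginal p k j.
pose J : Type := (grid K n + grid K n + 'I_K * nat + unit)%type.
(* Nonnegativity, support, decreasing remainders, and the mean invariant. *)
pose cst (j : J) (p : grid K n -> R) : R := match j with
  | inl (inl (inl x)) => p x
  | inl (inl (inr x)) => if (\sum_k x k <= n + (K + 3))%N then 0 else - p x
  | inl (inr (k, j)) => rem p k j - rem p k j.+1
  | inr tt => n%:R * (1 - \sum_x p x) - \sum_k \sum_(j < n.+1) j%:R * rem p k j
  end.
have cstP p : (forall j, 0 <= cst j p) <-> [/\ forall x, 0 <= p x,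
    forall x, p x != 0 -> (\sum_k x k <= n + (K + 3))%N,
    forall k j, rem p k j.+1 <= rem p k j &
    \sum_k \sum_(j < n.+1) j%:R * rem p k j <= n%:R * (1 - \sum_x p x)].
  split=> [H|[p0 ps pd pm]].
    have p0 x : 0 <= p x by exact: (H (inl (inl (inl x)))).
    split => //.
    - move=> x; apply: contraNT => xs; have := H (inl (inl (inr x))).
      by rewrite /= (negbTE xs) oppr_ge0 => px; rewrite eq_le px p0.
    - by move=> k j; have := H (inl (inr (k, j))); rewrite /= subr_ge0.
    - by have := H (inr tt); rewrite /= subr_ge0.
  move=> [[[x|x]|[k j]]|[]] /=; rewrite ?subr_ge0//.
  case: ifPn => // xs; rewrite oppr_ge0 le_eqVlt; apply/orP; left.
  by apply: contraNT xs => /ps.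
have remM p k : \sum_(j < n.+1) rem p k j = 1 - \sum_x p x.
  by rewrite sumrB f1 marginal_sum.
have remn p k j : (n < j)%N -> rem p k j = 0.
  by move=> nj; rewrite /rem fn// marginal_out// subrr.
have p1 p : (forall j, 0 <= cst j p) -> \sum_x p x <= 1.
  move=> /cstP[_ _ pd _]; rewrite -subr_ge0 -(remM p (Ordinal K0)).
  by apply: sumr_ge0 => j _; exact: (@decr_ge0 R n _ (pd _) (remn p _)).
pose V := 'rV[R]_#|grid K n|.
pose F (v : V) : grid K n -> R := fun x => v ord0 (enum_rank x).
have cm k j : continuous (fun v : V => marginal (F v) k j).
  exact: continuous_sum_coord.
have cr k j : continuous (fun v : V => rem (F v) k j).
  by move=> v; exact: (cvgB (cvg_cst (f k j)) (cm k j v)).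
have cs : continuous (fun v : V => \sum_x F v x).
  exact: continuous_sum_coord.
have c1 : continuous (fun v : V => 1 - \sum_x F v x).
  by move=> v; exact: (cvgB (cvg_cst (1 : R)) (cs v)).
have c2 : continuous (fun v : V => n%:R * (1 - \sum_x F v x)).
  by move=> v; exact: (cvgM (cvg_cst (n%:R : R)) (c1 v)).
have c3 : continuous (fun v : V =>
    \sum_k \sum_(j < n.+1) j%:R * rem (F v) k j).
  move=> v; apply: (@cvg_big _ _ _ _ _ add_continuous _ (nbhs v)) => k _.
  apply: (@cvg_big _ _ _ _ _ add_continuous _ (nbhs v)) => j _.
  exact: (cvgM (cvg_cst (j%:R : R)) (cr k j v)).
have [||||p pA pmax] :=
  @polytope_max R (grid K n) J cst (fun p => \sum_x p x) 1 ler01.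
- move=> [[[x|x]|[k j]]|[]].
  + exact: coord_continuous.
  + rewrite /cst; case: (\sum_k x k <= n + (K + 3))%N.
      exact: cst_continuous.
    by move=> v; exact: (cvgN (@coord_continuous _ _ _ _ _ v)).
  + by move=> v; exact: (cvgB (cr k j v) (cr k j.+1 v)).
  + by move=> v; exact: (cvgB (c2 v) (c3 v)).
- exact: cs.
- exists (fun=> 0); apply/cstP.
  have r0 k j : rem (fun=> 0) k j = f k j by rewrite /rem /marginal big1 ?subr0.
  split => //.
  + by move=> x; rewrite eqxx.
  + by move=> k j; rewrite !r0.
  + rewrite [in leRHS]big1// subr0 mulr1; apply: le_trans fmean.
    by apply: ler_sum => k _; apply: ler_sum => j _; rewrite r0.
- move=> p pA x; have [p0 _ _ _] := (cstP p).1 pA.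
  rewrite ger0_norm//; apply: le_trans (p1 p pA).
  by rewrite (bigD1 x)//= lerDl sumr_ge0.
have [p0 ps pd pm] := (cstP p).1 pA.
have psum : \sum_x p x = 1.
  apply/eqP; rewrite eq_le p1//= leNgt; apply/negP => plt.
  have M0 : 0 < 1 - \sum_x p x by rewrite subr_gt0.
  have [q [q0 qs q1 qd qm]] := extend_coupling n0 pd (remn p) (remM p) M0 pm.
  have E k j : rem (fun x => p x + q x) k j = rem p k j - marginal q k j.
    by rewrite /rem marginal_add opprD addrA.
  have /pmax : forall j, 0 <= cst j (fun x => p x + q x).
    apply/cstP; split.
    - by move=> x; rewrite addr_ge0.
    - move=> x; have [->|px _] := eqVneq (p x) 0; last exact: ps.
      by rewrite add0r; exact: qs.
    - by move=> k j; rewrite !E.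
    - under eq_bigr do under eq_bigr do rewrite E.
      by rewrite big_split/= opprD addrA.
  by rewrite big_split/= gerDl leNgt q1.
exists p; split => // k j; apply/esym/eqP; rewrite -subr_eq0; apply/eqP.
have [jn|jn] := ltnP n j; first exact: remn.
have := remM p k; rewrite psum subrr => /psumr_eq0P H.
apply: (H _ (Ordinal (jn : j < n.+1)%N)) => // i _.
exact: (@decr_ge0 R n _ (pd _) (remn p _)).
Qed.

(** * Atomless variables on an atomless space *)

Section atomless_variable.
Variables (d : measure_display) (T : measurableType d) (R : realType).
Variables (P : probability T R).
Hypothesis hP : atomless P.

Let p (A : set T) : R := fine (P A).

Let pE A : measurable A -> P A = (p A)%:E.
Proof. by move=> mA; rewrite fineK// fin_num_measure. Qed.

Let p_ge0 A : 0 <= p A. Proof. by rewrite fine_ge0. Qed.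

Let p0 : p set0 = 0. Proof. by rewrite /p measure0. Qed.

Let p_le A B : measurable A -> measurable B -> A `<=` B -> p A <= p B.
Proof.
by move=> mA mB AB; rewrite -lee_fin -!pE// le_measure ?inE.
Qed.

Let p_le1 A : measurable A -> p A <= 1.
Proof. by move=> mA; rewrite -lee_fin -pE// probability_le1. Qed.

Let pD A B : measurable A -> measurable B -> B `<=` A -> p (A `\` B) = p A - p
  B.
Proof.
move=> mA mB BA; have mD := measurableD mA mB.
apply/eqP; rewrite eq_sym subr_eq; apply/eqP/EFin_inj.
rewrite EFinD -!pE// -measureU//; first by rewrite setUC setDUK.
by rewrite setIC setDIK.
Qed.

(** The factor 2 leaves room to choose C without the supremum of the masses
    being attained.  A split is then small only if all parts of B of at most
    half its mass are small. *)
Lemma half_split (B : set T) : exists C, measurable B ->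
  [/\ measurable C, C `<=` B, p C <= p B / 2 &
    forall D, measurable D -> D `<=` B -> p D <= p B / 2 -> p D <= 2 * p C].
Proof.
have [mB|nB] := pselect (measurable B); last by exists set0.
pose S := [set x | exists D, [/\ measurable D, D `<=` B, p D <= p B / 2 &
  x = p D]].
have S0 : S 0.
  by exists set0; split => //; rewrite p0// divr_ge0.
have supS : has_sup S.
  split; first by exists 0.
  by exists 1 => x [D [mD _ _ ->]]; exact: p_le1.
have [s0|s0] := leP (sup S) 0.
  exists set0 => _; split => //; first by rewrite p0 divr_ge0.
  move=> D mD DB Dh; rewrite p0 mulr0; apply: le_trans s0.
  by apply: sup_upper_bound => //; exists D.
have [|x [C [mC CB Ch ->]] Cs] := @sup_adherent _ S (sup S / 2) _ supS.
  by rewrite divr_gt0.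
exists C => _; split => // D mD DB Dh.
have : p D <= sup S by apply: sup_upper_bound => //; exists D.
by move: Cs; lra.
Qed.

(** Splitting repeatedly by [half_split] gives a binary tree of sets, and h
    reads the path of a point in the tree in base 3, from which it can be
    recovered.  So a level set of h lies in all cells along one branch.  If it
    had positive mass, it would contain a set D of positive mass at most half
    of its own; then every split along the branch would remove at least half of
    the mass of D, which is impossible. *)
Lemma atomless_rv : exists2 h : T -> R, measurable_fun setT h &
  (forall t, 0 <= h t < 1) /\ forall x, P (h @^-1` [set x]) = 0%E.
Proof.
have [sp spP] := choice half_split.
pose cell := fix cell (s : seq bool) : set T := match s with
  | [::] => setT
  | b :: s' => if b then sp (cell s') else cell s' `\` sp (cell s') end.
have mcell s : measurable (cell s).
  elim: s => [|b s IH] /=; first exact: measurableT.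
  have [mC _ _ _] := spP _ IH.
  by case: b => //; exact: measurableD.
pose bit (s : seq bool) t := `[< sp (cell s) t >].
pose trace := fix trace n (t : T) : seq bool :=
  if n is n'.+1 then bit (trace n' t) t :: trace n' t else [::].
have traceP n : forall s, size s = n -> [set t | trace n t = s] = cell s.
  elim: n => [|n IH] [|b s]//=; first by move=> _; apply/seteqP; split.
  move=> [sn].
  have [_ sB _ _] := spP _ (mcell s).
  apply/seteqP; split=> t /=.
    move=> [E1 E2]; have ct : cell s t by rewrite -(IH s sn).
    move: E1; rewrite E2 /bit; case: b => [/asboolP//|/negbT/asboolPn E].
    by split.
  have H : cell s t -> trace n t = s by rewrite -(IH s sn).
  case: b => [st|[ct st]].
    by rewrite (H (sB _ st)); congr cons; apply/asboolP.
  by rewrite (H ct); congr cons; apply/negbTE/asboolPn.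
have size_trace n t : size (trace n t) = n by elim: n => //= n ->.
have cell_trace n t : cell (trace n t) t.
  by rewrite -(traceP n _ (size_trace n t)).
pose u n t : R := \sum_(i < n) (bit (trace i t) t)%:R / 3 ^+ i.+1.
(* The tail of the expansion after n digits is at most 3^-n / 2, so that
   h t lies in [u n t, v n t]. *)
pose v n t : R := u n t + (3 ^+ n)^-1 / 2.
have uS n t : u n.+1 t = u n t + (bit (trace n t) t)%:R / 3 ^+ n.+1.
  by rewrite /u big_ord_recr.
have i3 n : (0 : R) < (3 ^+ n)^-1 by rewrite invr_gt0 exprn_gt0.
have i3S n : ((3 : R) ^+ n.+1)^-1 = (3 ^+ n)^-1 / 3.
  by rewrite exprS invfM mulrC.
have bb (b : bool) : 0 <= (b%:R : R) <= 1 by case: b; rewrite ?lexx ?ler01.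
have u_incr t : nondecreasing_seq (u ^~ t).
  apply/nondecreasing_seqP => n; rewrite uS lerDl.
  by rewrite divr_ge0// exprn_ge0.
have v_decr t : nonincreasing_seq (v ^~ t).
  apply/nonincreasing_seqP => n; rewrite /v uS i3S.
  have := i3 n; have /andP[] := bb (bit (trace n t) t); nra.
have uv m n t : u m t <= v n t.
  apply: le_trans (u_incr t _ _ (leq_maxl m n)) _.
  apply: le_trans (v_decr t _ _ (leq_maxr m n)).
  by rewrite /v lerDl divr_ge0// ltW.
have cu t : cvgn (u ^~ t).
  apply: nondecreasing_is_cvgn; first exact: u_incr.
  by exists (v 0%N t) => _ [n _ <-]; exact: uv.
pose h t := limn (u ^~ t).
have uh n t : u n t <= h t by apply: nondecreasing_cvgn_le.
have hv n t : h t <= v n t by apply: limr_le => //; near=> m; exact: uv.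
have u_trace n t t' : trace n t = trace n t' -> u n t = u n t'.
  elim: n => [|n IH]; first by rewrite /u !big_ord0.
  by move=> [E1 E2]; rewrite !uS IH// E1.
have mu n : measurable_fun setT (u n).
  elim: n => [|n IH].
    rewrite (_ : u 0%N = cst 0)//; by apply/funext => t; rewrite /u big_ord0.
  have -> : u n.+1 = u n \+
      (fun t => \1_([set t | bit (trace n t) t]) t / 3 ^+ n.+1).
    apply/funext => t; rewrite uS/= indicE; congr (_ + (nat_of_bool _)%:R / _).
    by apply/idP/idP; rewrite inE.
  apply: measurable_funD => //; apply: measurable_funM => //.
  apply: measurable_indic.
  rewrite (_ : [set t | _] = \bigcup_(s in [set: n.-tuple bool])
      [set t | trace n.+1 t = true :: s]).
    apply: fin_bigcup_measurable => [|s _]; first exact: finite_finset.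
    by rewrite traceP; [exact: mcell|rewrite /= size_tuple].
  apply/seteqP; split=> t /=.
    by move=> bt; exists (Tuple (introT eqP (size_trace n t))); rewrite //= bt.
  by move=> [s _ /= [->]].
have mh : measurable_fun setT h.
  by apply: (measurable_fun_cvg (h := u)) => // t _; exact: cu.
have h_trace t t' : h t = h t' -> forall n, trace n t = trace n t'.
  move=> E; elim=> //= n IH; rewrite IH; congr cons.
  have := uh n.+1 t; have := hv n.+1 t; have := uh n.+1 t'; have := hv n.+1 t'.
  rewrite /v !uS i3S (u_trace _ _ _ IH) E IH.
  have := i3 n; case: (bit _ t); case: (bit _ t') => //= h1 h2 h3 h4 h5;
    exfalso; lra.
exists h => //; split.
  move=> t; have := uh 0%N t; have := hv 0%N t.
  rewrite /v /u !big_ord0 expr0; lra.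
move=> x; apply: contrapT => /eqP Px.
set A := h @^-1` [set x] in Px.
have mA : measurable A by rewrite -[A]setTI; exact: mh.
have A0 : (0 < P A)%E by rewrite lt0e Px measure_ge0.
have [B [mB BA B0 BlA]] := hP mA A0.
have pB0 : 0 < p B by rewrite -lte_fin -pE.
have pBA : p B < p A by rewrite -lte_fin -!pE.
(* One of B and its complement in A has at most half of the mass of A. *)
have [D [mD DA D0 Dh]] : exists D, [/\ measurable D, D `<=` A, 0 < p D &
    p D <= p A / 2].
  have [Bh|Bh] := leP (p B) (p A / 2); first by exists B.
  exists (A `\` B); split; first exact: measurableD.
  - by move=> t [].
  - by rewrite pD// subr_gt0.
  - by rewrite pD//; lra.
have [w Aw] : A !=set0.
  by apply/set0P; apply: contra_neq Px => ->; rewrite measure0.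
have AC n : A `<=` cell (trace n w).
  move=> t At; rewrite (h_trace w t) ?cell_trace//.
  by rewrite (Aw : h w = x) (At : h t = x).
have dec n : p (cell (trace n w)) <= 1 - n%:R * (p D / 2).
  elim: n => [|n IH]; first by rewrite mul0r subr0 p_le1.
  have mC := mcell (trace n w).
  have [mS SC Sh SD] := spP _ mC.
  have AlC := p_le mA mC (AC n).
  have DC : p D <= 2 * p (sp (cell (trace n w))).
    apply: SD => //; first exact: subset_trans DA (AC n).
    by apply: le_trans Dh _; lra.
  rewrite -natr1 mulrDl mul1r /=; case: (bit _ _); first by lra.
  by rewrite pD//; lra.
have := dec (Num.trunc (p D / 2)^-1).+1.
have : (p D / 2)^-1 < (Num.trunc (p D / 2)^-1).+1%:R by exact: truncnS_gt.
rewrite -[ltLHS]div1r ltr_pdivrMr ?divr_gt0// => h1 h2.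
have := p_ge0 (cell (trace (Num.trunc (p D / 2)^-1).+1 w)).
by lra.
Unshelve. all: by end_near.
Qed.

End atomless_variable.

(** * The probability integral transform *)

Lemma uniform_prob_lt_clip (R : realType) (x : R) :
  uniform_prob (@ltr01 R) `]-oo, x[ = (Num.max 0 (Num.min 1 x))%:E.
Proof.
rewrite -uniform_prob_le_clip !uniform_prob_itv//.
have -> : `]-oo, x]%classic `&` `[0, 1]%classic =
    (`]-oo, x[%classic `&` `[0, 1]%classic) `|` ([set x] `&` `[0, 1]%classic).
  rewrite -setIUl; congr (_ `&` _); apply/seteqP; split=> y /=;
    rewrite !in_itv/=.
    by rewrite le_eqVlt => /predU1P[->|]; [right|left].
  by case=> [/ltW//|->].
apply/eqP; rewrite eq_le; apply/andP; split.
  apply: le_measure; rewrite ?inE.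
  - exact: measurableI.
  - by apply: measurableU; apply: measurableI.
  - by move=> y ?; left.
apply: le_trans (measureU2 _ _ _) _; [exact: measurableI|exact: measurableI|].
rewrite [X in (_ + X)%E](_ : _ = 0%E) ?adde0//.
apply: (subset_measure0 _ _ _ (lebesgue_measure_set1 x)) => //.
exact: measurableI.
Qed.

Lemma uniform01_lt d (T : measurableType d) (R : realType) (P : probability T R)
    (U : {RV P >-> R}) :
  (forall x, P (U @^-1` `]-oo, x[) = (Num.max 0 (Num.min 1 x))%:E) ->
  uniform01 U.
Proof.
move=> H A mA.
(* [measure_unique] speaks of a generated sigma-algebra; U' is U with the
   Borel sigma-algebra presented in this way. *)
have mU : measurable_fun setT (U : T -> measurableTypeR R).
  by move=> mT Y mY; exact: (@measurable_funP _ _ _ _ setT U mT Y mY).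
pose U' : {mfun T >-> measurableTypeR R} :=
  @mfun_Sub _ _ T (measurableTypeR R) U (mem_set mU).
pose m1 : {measure set (measurableTypeR R) -> \bar R} := distribution P U'.
pose m2 : {measure set (measurableTypeR R) -> \bar R} := uniform_prob (@ltr01
  R).
apply: (@measure_unique _ R (measurableTypeR R) (@RGenInftyO.G R)
  (fun n => `]-oo, n%:R[%classic) _ _ _ _ m1 m2) => //.
- exact: RGenInftyO.measurableE.
- move=> _ _ [x ->] [y ->]; exists (Num.min x y).
  by apply/seteqP; split=> z /=; rewrite !in_itv/= lt_min;
    [move=> [-> ->]|move=> /andP].
- by move=> n; exists n%:R.
- apply/seteqP; split=> // x _; exists (Num.trunc x).+1 => //=.
  by rewrite in_itv/= truncnS_gt.
- by move=> _ [x ->]; exact: etrans (H x) (esym (uniform_prob_lt_clip x)).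
- by move=> n; rewrite ltey_eq fin_num_measure.
Qed.

Section integral_transform.
Variables (d : measure_display) (T : measurableType d) (R : realType).
Variables (P : probability T R) (X : {RV P >-> R}).
Hypothesis X0 : forall x, P (X @^-1` [set x]) = 0%E.

Let mX A : measurable A -> measurable (X @^-1` A).
Proof. by move=> mA; rewrite -[X @^-1` A]setTI; exact: measurable_funP. Qed.

(** The value x is taken at the supremum of the points where the distribution
    function is below x: right continuity gives one inequality, and continuity
    from below together with the absence of atoms gives the other one. *)
Lemma cdf_onto (x : R) : 0 < x < 1 -> exists y, cdf X y = x%:E.
Proof.
move=> /andP[x0 x1].
pose S := [set y | (cdf X y < x%:E)%E].
have [a aS] : exists a, S a.
  apply: contrapT => nS; suff : (x%:E <= 0)%E by rewrite lee_fin leNgt x0.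
  apply: (cvge_ge _ (@cvg_cdfNy0 _ _ _ P X)); apply: nearW => y.
  by rewrite leNgt; apply/negP => yS; apply: nS; exists y.
have [b bS] : exists b, (x%:E <= cdf X b)%E.
  apply: contrapT => nS; suff : (1 <= x%:E)%E by rewrite lee_fin leNgt x1.
  apply: (cvge_le _ (@cvg_cdfy1 _ _ _ P X)); apply: nearW => y.
  by rewrite leNgt; apply/negP => /ltW yS; apply: nS; exists y.
have supS : has_sup S.
  split; first by exists a.
  exists b => y yS; rewrite leNgt; apply/negP => bly.
  have : (x%:E <= cdf X y)%E by apply: le_trans bS _; apply: cdf_nondecreasing;
    exact: ltW.
  by rewrite leNgt => /negP; apply.
exists (sup S); apply/eqP; rewrite eq_le; apply/andP; split.
  have -> : cdf X (sup S) = P (X @^-1` `]-oo, sup S[).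
    rewrite -[RHS]adde0 -(X0 (sup S)) -measureU; [|exact: mX|exact: mX|].
      congr (P _); apply/seteqP; split=> t /=; rewrite !in_itv/=.
        by rewrite le_eqVlt => /predU1P[->|]; [right|left].
      by case=> [/ltW//|->].
    apply/seteqP; split=> t //= []; rewrite in_itv/= => /[swap] ->.
    by rewrite ltxx.
  pose F n := X @^-1` `]-oo, sup S - n.+1%:R^-1].
  have UF : X @^-1` `]-oo, sup S[ = \bigcup_n F n.
    rewrite -preimage_bigcup; congr (X @^-1` _).
    rewrite -[LHS]setCK setCitvl itvcyEbigcap setC_bigcap.
    by apply: eq_bigcupr => n _; rewrite setCitvr.
  have Fcvg : P (F n) @[n --> \oo] --> P (X @^-1` `]-oo, sup S[).
    rewrite UF; apply: nondecreasing_cvg_mu; first by move=> n; exact: mX.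
      by apply: bigcupT_measurable => n; exact: mX.
    move=> m n mn; apply/subsetPset => t; rewrite /F/= !in_itv/= => /le_trans;
      apply.
    by rewrite lerD2l lerN2 lef_pV2 ?posrE// ler_nat.
  apply: (cvge_le _ Fcvg); apply: nearW => n.
  have [y yS yn] : exists2 y, S y & sup S - n.+1%:R^-1 < y.
    by apply: sup_adherent => //; rewrite invr_gt0.
  by apply: le_trans (ltW yS); apply: cdf_nondecreasing; exact: ltW.
apply: (@cvge_ge _ _ _ _ _ _ _ _ (@cdf_right_continuous _ _ _ P X (sup S))).
near=> y; rewrite leNgt; apply/negP => yS.
have : y <= sup S by apply: sup_upper_bound.
by rewrite leNgt => /negP; apply; near: y; exact: nbhs_right_gt.
Unshelve. all: by end_near.
Qed.

(** Each value of ]0, 1[ is a value of the distribution function; comparing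
    the event U < x with the events X <= y, where the distribution function has
    a value close to x at y, gives both bounds on its probability. *)
Lemma integral_transform : exists2 U : {RV P >-> R}, uniform01 U &
  forall t, (U t)%:E = cdf X (X t).
Proof.
have mU : measurable_fun setT (fun t => fine (cdf X (X t))).
  apply: measurableT_comp => //.
  exact: (measurableT_comp (@cdf_measurable _ _ _ P X) (measurable_funP X)).
pose U : {RV P >-> R} := mfun_Sub (mem_set mU).
have UE t : (U t)%:E = cdf X (X t).
  by rewrite -[RHS]fineK// fin_num_measure.
have U0 t : 0 <= U t by rewrite -lee_fin UE.
have U1 t : U t <= 1 by rewrite -lee_fin UE cdf_le1.
have mUi A : measurable A -> measurable (U @^-1` A).
  by move=> mA; rewrite -[U @^-1` A]setTI; exact: measurable_funP.
have up x : 0 < x < 1 -> (P (U @^-1` `]-oo, x[) <= x%:E)%E.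
  move=> /cdf_onto[y Fy]; rewrite -Fy; apply: le_measure; rewrite ?inE.
  - exact: mUi.
  - exact: mX.
  move=> t /=; rewrite !in_itv/= -lte_fin UE -Fy => H.
  by rewrite leNgt; apply: contraTN H => /ltW yX;
    rewrite -leNgt cdf_nondecreasing.
have lo x y : 0 < x < 1 -> x < y -> (x%:E <= P (U @^-1` `]-oo, y[))%E.
  move=> /cdf_onto[z Fz] xy; rewrite -Fz.
  apply: (@le_measure _ _ _ P (X @^-1` `]-oo, z]) (U @^-1` `]-oo, y[)).
  - by rewrite inE; exact: mX.
  - by rewrite inE; exact: mUi.
  move=> t /=; rewrite !in_itv/= -lte_fin UE => H.
  by apply: le_lt_trans (@cdf_nondecreasing _ _ _ P X _ _ H) _;
    rewrite Fz lte_fin.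
exists U => //; apply: uniform01_lt => x.
have [x0|x0] := leP x 0.
  rewrite min_r ?(le_trans x0)// max_l// (_ : _ @^-1` _ = set0) ?measure0//.
  apply/seteqP; split=> t //=; rewrite in_itv/= ltNge => /negP; apply.
  exact: le_trans x0 (U0 t).
have [x1|x1] := ltP 1 x.
  rewrite max_r// (_ : _ @^-1` _ = setT) ?probability_setT//.
  apply/seteqP; split=> t //= _; rewrite in_itv/=; exact: le_lt_trans (U1 t) x1.
rewrite max_r; last exact: ltW.
have Pfin : P (U @^-1` `]-oo, x[) = (fine (P (U @^-1` `]-oo, x[)))%:E.
  by rewrite fineK// fin_num_measure//; exact: mUi.
apply/eqP; rewrite eq_le; apply/andP; split.
  have [->|xn1] := eqVneq x 1; first exact: probability_le1 (mUi _ _).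
  by apply: up; rewrite x0 lt_neqAle xn1 x1.
rewrite Pfin lee_fin; apply/ler_addgt0Pr => e e0.
have [xe|xe] := leP x e; first by rewrite (le_trans xe)// lerDr fine_ge0.
rewrite -lerBlDr -lee_fin -Pfin; apply: lo; lra.
Qed.

End integral_transform.

(** * Discretised quantiles of a scaled power of a uniform variable *)

(** The convex function t^(r+1) lies above its tangents; this is an instance
    of the inequality of Young for the exponents r + 1 and (r + 1) / r. *)
Lemma powR_tangent (R : realType) (r u v : R) : 0 < r -> 0 <= u -> 0 <= v ->
  v `^ r * (u - v) <= (u `^ (r + 1) - v `^ (r + 1)) / (r + 1).
Proof.
move=> r0 u0 v0; have r1 : 0 < r + 1 by rewrite addr_gt0.
have vr : v `^ (r + 1) = v `^ r * v.
  by rewrite powRD ?powRr1// gt_eqF.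
have q0 : 0 < (r + 1) / r by rewrite divr_gt0.
have := @conjugate_powR R u (v `^ r) (r + 1) ((r + 1) / r) u0 (powR_ge0 _ _) r1
  q0.
have -> : (v `^ r) `^ ((r + 1) / r) = v `^ (r + 1).
  by rewrite -powRrM mulrCA divff ?gt_eqF// mulr1.
have -> : (r + 1)^-1 + ((r + 1) / r)^-1 = 1.
  by field; rewrite !gt_eqF.
move=> /(_ erefl).
have -> : v `^ (r + 1) / ((r + 1) / r) = v `^ (r + 1) - v `^ (r + 1) / (r + 1).
  by field; rewrite !gt_eqF.
rewrite mulrBl mulrBr -vr; lra.
Qed.

Lemma powR_midpoint (R : realType) (r a b : R) : 1 <= r -> 0 <= a -> 0 <= b ->
  ((a + b) / 2) `^ r <= (a `^ r + b `^ r) / 2.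
Proof.
move=> r1 a0 b0.
have h0 : (0 : R) <= 2^-1 by rewrite invr_ge0.
have h1 : (2^-1 : R) <= 1 by rewrite invf_le1// ler1n.
have cv := @convex_powR R r r1 (Itv01 h0 h1) a b.
rewrite !inE/= !in_itv/= !andbT in cv.
move: {cv}(cv a0 b0) => cv.
rewrite convRE [X in X `^ _ <= _]convRE/= /unstable.onem in cv.
have hh : (1 - 2^-1 : R) = 2^-1 by lra.
by move: cv; rewrite hh -!mulrDr mulrC [leRHS]mulrC.
Qed.

(** For j > 0, q j is the probability that w V^r <= j e, with V uniform on
    [0, 1].  The
    increments of q decrease because t^r is convex.  The last inequality
    compares a lower sum with the mean w / (r + 1) of w V^r: by [powR_tangent]
    the terms are bounded by a telescoping sum. *)
Lemma discrete_quantile (R : realType) (r w e : R) (n : nat) : 1 <= r ->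
  0 <= w -> 0 < e -> w <= n%:R * e ->
  exists q : nat -> R, [/\ q 0%N = 0,
    forall j, q j <= q j.+1,
    (forall j, q j.+2 - q j.+1 <= q j.+1 - q j) /\
    (forall j, (n <= j)%N -> (0 < j)%N -> q j = 1),
    forall j, w * q j `^ r <= j%:R * e &
    \sum_(j < n.+1) j%:R * e * (q j.+1 - q j) <= w / (r + 1)].
Proof.
move=> r1 w0 e0 wn; have r0 : 0 < r by exact: lt_le_trans r1.
have rV0 : 0 < r^-1 by rewrite invr_gt0.
have [->|wn0] := eqVneq w 0.
  exists (fun j => (j != 0%N)%:R); split => //.
  - by case=> [|j] /=; rewrite ?ler01.
  - split; [by case=> [|j] /=; rewrite ?subrr ?subr0 ?ler01|].
    by move=> [|j].
  - by move=> j; rewrite mul0r mulr_ge0// ltW.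
  - rewrite mul0r big_ord_recl/= !mul0r add0r big1// => j _ /=.
    by rewrite subrr mulr0.
have w1 : 0 < w by rewrite lt_neqAle eq_sym wn0.
pose y j := (j%:R * e / w) `^ r^-1.
have je j : 0 <= j%:R * e / w by rewrite divr_ge0 ?mulr_ge0// ltW.
have r0' := ltW r0; have rV0' := ltW rV0; have e0' := ltW e0.
have yr j : y j `^ r = j%:R * e / w.
  by rewrite -powRrM mulVf ?gt_eqF// powRr1.
have y0 j : 0 <= y j by exact: powR_ge0.
pose q j := Num.min 1 (y j).
have q0 j : 0 <= q j by rewrite le_min ler01 y0.
have q1 j : q j <= 1 by rewrite ge_min lexx.
have qr j : q j `^ r <= j%:R * e / w.
  by rewrite -yr; apply: ge0_ler_powR; rewrite ?nnegrE// /q ge_min lexx orbT.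
have ymono j : y j <= y j.+1.
  apply: ge0_ler_powR; rewrite ?nnegrE ?je//.
  by rewrite !ler_pM2r ?invr_gt0// ler_nat.
have qmono j : q j <= q j.+1.
  by rewrite le_min q1/= ge_min ymono orbT.
exists q; split => //.
- by rewrite /q /y !mul0r powR0 ?gt_eqF// min_r.
- split=> j.
    suff : (q j + q j.+2) / 2 <= q j.+1 by lra.
    rewrite le_min; apply/andP; split.
      by have := q1 j; have := q1 j.+2; lra.
    have ab0 : 0 <= (q j + q j.+2) / 2 by have := q0 j; have := q0 j.+2; lra.
    have E x : 0 <= x -> x = (x `^ r) `^ r^-1.
      by move=> x0; rewrite -powRrM mulfV ?gt_eqF// powRr1.
    rewrite [leLHS]E//.
    apply: ge0_ler_powR; rewrite ?nnegrE ?powR_ge0 ?je//.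
    apply: le_trans (powR_midpoint r1 (q0 j) (q0 j.+2)) _.
    have E1 : j.+1%:R * e / w = j%:R * e / w + e / w.
      by rewrite -(natr1 j) !mulrDl mul1r.
    have E2 : j.+2%:R * e / w = j%:R * e / w + 2 * (e / w).
      by rewrite -(natr1 j.+1) -(natr1 j); ring.
    move: (qr j) (qr j.+2); rewrite E1 E2.
    move: (q j `^ r) (q j.+2 `^ r) (j%:R * e / w) (e / w).
    by clear => a b x y; lra.
  move=> nj j0; rewrite /q min_l//.
  rewrite -[leLHS](congr1 (fun f => f r^-1) (@powR1 R)).
  apply: ge0_ler_powR; rewrite ?nnegrE ?je//.
  rewrite ler_pdivlMr// mul1r; apply: le_trans wn _.
  by rewrite ler_pM2r// ler_nat.
- by move=> j; rewrite mulrC -ler_pdivlMr.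
apply: (@le_trans _ _ (\sum_(j < n.+1)
    (w / (r + 1) * q j.+1 `^ (r + 1) - w / (r + 1) * q j `^ (r + 1)))).
  apply: ler_sum => j _.
  have [y1|y1] := leP 1 (y j).
    have -> : q j = 1 by rewrite /q min_l.
    have -> : q j.+1 = 1 by rewrite /q min_l// (le_trans y1).
    by rewrite !subrr mulr0.
  have qj : j%:R * e = w * q j `^ r.
    have -> : q j = y j by rewrite /q min_r// ltW.
    by rewrite yr [RHS]mulrC divfK.
  rewrite qj -mulrBr -!mulrA ler_pM2l//.
  by rewrite [_^-1 * _]mulrC powR_tangent.
rewrite -(big_mkord xpredT (fun j => w / (r + 1) * q j.+1 `^ (r + 1) -
  w / (r + 1) * q j `^ (r + 1))) telescope_sumr//.
have c0 : 0 <= w / (r + 1) by rewrite divr_ge0// addr_ge0 ?ltW.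
have p1 : q n.+1 `^ (r + 1) <= 1.
  rewrite -[leRHS](congr1 (fun f => f (r + 1)) (@powR1 R)).
  by apply: ge0_ler_powR; rewrite ?nnegrE ?addr_ge0.
rewrite -mulrBr -[leRHS]mulr1 ler_wpM2l// lerBlDr.
by rewrite (le_trans p1)// lerDl powR_ge0.
Qed.

(** * Realising a finite coupling by uniform variables *)

Lemma uniform_prob_co (R : realType) (a b : R) : 0 <= a -> a <= b -> b <= 1 ->
  uniform_prob (@ltr01 R) `[a, b[ = (b - a)%:E.
Proof.
move=> a0 ab b1; rewrite uniform_prob_itv//.
rewrite (_ : _ `&` _ = `[a, b[%classic); last first.
  apply/seteqP; split=> y /=; rewrite !in_itv/=; first by case.
  move=> /andP[ay yb]; rewrite ay yb; split => //=.
  by rewrite (le_trans a0 ay)/= (le_trans (ltW yb)).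
rewrite lebesgue_measure_itv/= lte_fin; case: ifPn => [_|];
  first by rewrite EFinB.
by rewrite -leNgt => ba; rewrite (_ : b = a) ?subrr//; apply/eqP;
  rewrite eq_le ab ba.
Qed.

Lemma measurable_finite_pred d (T : measurableType d) (I : finType)
    (J : T -> I) (Q : pred I) :
  (forall i, measurable (J @^-1` [set i])) -> measurable [set t | Q (J t)].
Proof.
move=> mJ.
rewrite (_ : [set t | _] = \bigcup_(i in [set i | Q i]) (J @^-1` [set i])).
  by apply: fin_bigcup_measurable => //; exact: finite_finset.
apply/seteqP; split=> t /=; first by move=> Qt; exists (J t).
by move=> [i /= Qi ->].
Qed.

Lemma measurable_finite_comp d (T : measurableType d) (R : realType)
    (I : finType) (J : T -> I) (f : I -> R) :
  (forall i, measurable (J @^-1` [set i])) ->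
  measurable_fun setT (fun t => f (J t)).
Proof.
move=> mJ _ Y _; rewrite setTI.
rewrite (_ : _ @^-1` Y = \bigcup_(i in [set i | Y (f i)]) (J @^-1` [set i])).
  by apply: fin_bigcup_measurable => //; exact: finite_finset.
apply/seteqP; split=> t /=; first by move=> Yt; exists (J t).
by move=> [i /= Yi ->].
Qed.

Section realization.
Variables (d : measure_display) (T : measurableType d) (R : realType).
Variables (P : probability T R).
Hypothesis hP : atomless P.

Lemma mfun_preimage d' (T' : measurableType d') (X : {mfun T >-> T'}) A :
  measurable A -> measurable (X @^-1` A).
Proof. by move=> mA; rewrite -[X @^-1` A]setTI; exact: measurable_funP. Qed.

(** The sets J = Some i are the preimages under a uniform variable of
    consecutive intervals of lengths p i; None collects the missing mass. *)
Lemma finite_law (I : finType) (p : I -> R) : (forall i, 0 <= p i) ->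
  \sum_i p i <= 1 ->
  exists J : T -> option I, (forall o, measurable (J @^-1` [set o])) /\
    forall i, P (J @^-1` [set Some i]) = (p i)%:E.
Proof.
move=> p0 p1; have [h mh [h01 hatom]] := atomless_rv hP.
pose H : {RV P >-> R} := mfun_Sub (mem_set mh).
have [V Vu _] := @integral_transform _ _ _ P H hatom.
pose c (m : nat) := \sum_(i | (enum_rank i < m)%N) p i.
have c0 m : 0 <= c m by exact: sumr_ge0.
have cS i : c (enum_rank i).+1 = c (enum_rank i) + p i.
  rewrite /c (bigD1 i)//= addrC; congr (_ + _); apply: eq_bigl => j.
  by rewrite ltnS ltn_neqAle andbC (inj_eq val_inj) (inj_eq enum_rank_inj).
have cle m m' : (m <= m')%N -> c m <= c m'.
  move=> mm; rewrite /c [leRHS](bigID (fun i => enum_rank i < m)%N)/=.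
  rewrite [X in _ <= X + _](eq_bigl (fun i => enum_rank i < m)%N).
    by rewrite lerDl sumr_ge0.
  by move=> i; case: (ltnP (enum_rank i) m) => im;
    rewrite ?andbF// (leq_trans im).
have c1 m : c m <= 1.
  apply: le_trans p1; rewrite /c [leRHS](bigID (fun i => enum_rank i < m)%N)/=.
  by rewrite lerDl sumr_ge0.
pose A (i : I) := V @^-1` `[c (enum_rank i), c (enum_rank i).+1[.
have mA i : measurable (A i) by exact: mfun_preimage.
have PA i : P (A i) = (p i)%:E.
  transitivity (uniform_prob (@ltr01 R) `[c (enum_rank i), c (enum_rank i).+1[).
    by rewrite -Vu.
  by rewrite uniform_prob_co// ?cle// cS addrAC subrr add0r.
have disj t i j : A i t -> A j t -> i = j.
  wlog ij : i j / (enum_rank i <= enum_rank j)%N.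
    move=> W Ai Aj; case/orP: (leq_total (enum_rank i) (enum_rank j)) => ij.
      exact: W.
    by symmetry; exact: W.
  rewrite /A/= !in_itv/= => /andP[_ h1] /andP[h2 _].
  apply: enum_rank_inj; apply/val_inj/eqP; rewrite eqn_leq ij/= leqNgt.
  apply/negP => /cle h3; have := le_lt_trans (le_trans h3 h2) h1.
  by rewrite ltxx.
pose J t := [pick i | `[< A i t >]].
have JS i : J @^-1` [set Some i] = A i.
  apply/seteqP; split=> t /=; rewrite /J; case: pickP => [j /asboolP Aj|nA] //.
  - by case=> <-.
  - by move=> Ai; congr Some; exact: disj Aj Ai.
  - by move=> Ai; have := nA i; move/asboolP.
exists J; split => [[i|]|i]; rewrite ?JS//.
rewrite (_ : _ @^-1` _ = ~` \bigcup_(i in [set: I]) A i).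
  apply: measurableC; apply: fin_bigcup_measurable => //; exact: finite_finset.
apply/seteqP; split=> t /=; rewrite /J; case: pickP => [i /asboolP Ai|nA] //.
- by move=> _ [i _ Ai]; have := nA i; move/asboolP.
- by move=> H'; exfalso; apply: H'; exists i.
Qed.

(** U is the integral transform of idx (J t) + h t, where h is atomless with
    values in [0, 1): its value at t is the probability of not being above t
    in the lexicographic order given by the index and h. *)
Lemma layered_uniform (I : finType) (J : T -> I) (idx : I -> nat) :
  (forall i, measurable (J @^-1` [set i])) ->
  exists2 U : {RV P >-> R}, uniform01 U &
    forall t, 0 <= U t /\
      U t <= \sum_(i | (idx i <= idx (J t))%N) fine (P (J @^-1` [set i])).
Proof.
move=> mJ; have [h mh [h01 hatom]] := atomless_rv hP.
pose g t := (idx (J t))%:R + h t.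
have mg : measurable_fun setT g.
  apply: measurable_funD => //.
  exact: (measurable_finite_comp (fun i => (idx i)%:R)).
pose G : {RV P >-> R} := mfun_Sub (mem_set mg).
have gtrunc t : Num.trunc (g t) = idx (J t).
  apply/eqP; rewrite eqn_leq truncn_le_nat -natr1 /g.
  have /andP[h0 h1] := h01 t; rewrite ltrD2l h1/=.
  by rewrite truncn_ge_nat ?lerDl// addr_ge0.
have Gatom x : P (G @^-1` [set x]) = 0%E.
  apply: (@subset_measure0 _ _ _ P _ (h @^-1` [set x - (Num.trunc x)%:R])).
  - exact: mfun_preimage.
  - by rewrite -[X in measurable X]setTI; exact: mh.
  - by move=> t /= <-; rewrite gtrunc /g addrC addKr.
  - exact: hatom.
have [U Uu UG] := @integral_transform _ _ _ P G Gatom.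
have mQ Q := measurable_finite_pred Q mJ.
exists U => // t; split; first by rewrite -lee_fin UG.
rewrite -lee_fin UG (sum_fibers P (fun i => idx i <= idx (J t))%N mJ) fineK.
  apply: (@le_measure _ _ _ P (G @^-1` `]-oo, G t])).
  - by rewrite inE; exact: mfun_preimage.
  - by rewrite inE; exact: (mQ (fun i => idx i <= idx (J t))%N).
  - move=> s /=; rewrite in_itv/= => gst.
    by rewrite -!gtrunc; exact: le_truncn.
by apply: fin_num_measure; exact: (mQ (fun i => idx i <= idx (J t))%N).
Qed.

End realization.

(** * The tail of a weighted sum of powers *)

(** A weighted union bound: the inequality of Markov for the combination of the
    indicators of the E i with coefficients a i. *)
Lemma weighted_cover d (T : measurableType d) (R : realType)
    (P : probability T R) (I : finType) (a : I -> R) (E : I -> set T)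
    (A : set T) :
  measurable A -> (forall i, measurable (E i)) -> (forall i, 0 <= a i) ->
  (forall t, A t -> 1 <= \sum_i a i * \1_(E i) t) ->
  (P A <= \sum_i (a i)%:E * P (E i))%E.
Proof.
move=> mA mE a0 cover.
have f0 i t : 0 <= a i * \1_(E i) t :> R by rewrite mulr_ge0.
have mf i : measurable_fun setT (fun t => a i * \1_(E i) t : R).
  by apply: measurable_funM => //; exact: measurable_indic.
apply: (@le_trans _ _ (\int[P]_t (\sum_i a i * \1_(E i) t)%R%:E)%E).
  rewrite -[X in P X]setIT -integral_indic//.
  apply: ge0_le_integral => //=.
  - by apply/measurable_EFinP; exact: measurable_indic.
  - by apply/measurable_EFinP; exact: measurable_sum.
  - move=> t _; rewrite lee_fin indicE.
    case: (boolP (t \in A)) => [|_]; first by rewrite inE; exact: cover.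
    by apply: sumr_ge0.
under eq_integral do rewrite -sumEFin.
rewrite ge0_integral_sum//; last 2 first.
- by move=> i; apply/measurable_EFinP; exact: mf.
- by move=> i t _; rewrite lee_fin.
apply: lee_sum => i _; under eq_integral do rewrite EFinM.
rewrite ge0_integralZl//; last 2 first.
- by apply/measurable_EFinP; exact: measurable_indic.
- by rewrite lee_fin.
by rewrite integral_indic// setIT.
Qed.

(** The dual function g is replaced by a step function on N + 1 intervals of
    length e / (N + 1), which is at least g.  Its expectation exceeds e by at
    most 2 / (N + 1), by comparing the Riemann sum with the telescoping sum of
    [powR_tangent]. *)
Lemma weighted_power_tail (R : realType) d (T : measurableType d) (P :
  probability T R)
    (K : nat) (w : K.-tuple R) (r e : R) (U : 'I_K -> {RV P >-> R})
    (A : set T) :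
  simplex w -> 1 <= r -> 0 < e < 1 -> (forall k, uniform01 (U k)) ->
  measurable A -> (forall t k, A t -> 0 <= U k t) ->
  (forall t, A t -> (r + 1) * (\sum_k tnth w k * U k t `^ r) <= e `^ r) ->
  (P A <= e%:E)%E.
Proof.
move=> [w01 w1] r1 /andP[e0 e1] Uu mA U0 US.
have r0 : 0 < r by exact: lt_le_trans r1.
have w0 k : 0 <= tnth w k by case/andP: (w01 k).
have er0 : 0 < e `^ r by exact: powR_gt0.
pose b := (r + 1) / (r * e `^ r).
have b0 : 0 <= b.
  by rewrite divr_ge0 ?mulr_ge0 ?addr_ge0 ?powR_ge0// ltW.
suff bound N : (P A <= (e + 2 / N.+1%:R)%:E)%E.
  have Pfin : P A = (fine (P A))%:E by rewrite fineK// fin_num_measure.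
  rewrite Pfin lee_fin; apply/ler_addgt0Pr => x x0.
  have := bound (Num.trunc (2 / x)); rewrite Pfin lee_fin => /le_trans; apply.
  rewrite lerD2l ler_pdivrMr// mulrC -ler_pdivrMr//; apply/ltW/truncnS_gt.
have N0 : (0 : R) < N.+1%:R by [].
pose v j : R := e * j%:R / N.+1%:R.
have vS j : v j.+1 - v j = e / N.+1%:R.
  by rewrite /v -(natr1 j); field; rewrite gt_eqF.
have v0 j : 0 <= v j by rewrite divr_ge0// mulr_ge0// ltW.
have vmono i j : (i <= j)%N -> v i <= v j.
  by move=> ij; rewrite /v ler_pM2r ?invr_gt0// ler_pM2l// ler_nat.
have v00 : v 0%N = 0 by rewrite /v mulr0 mul0r.
have vN : v N.+1 = e by rewrite /v mulfK// gt_eqF.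
have ve j : (j <= N.+1)%N -> v j <= e by move=> /vmono; rewrite vN.
have pmono x y : 0 <= x -> x <= y -> x `^ r <= y `^ r.
  move=> x0 xy; apply: ge0_ler_powR; rewrite ?nnegrE//; first exact: ltW.
  exact: le_trans xy.
pose a (i : 'I_K * 'I_N.+1) := tnth w i.1 * (b * (e `^ r - v i.2 `^ r)).
have c0 (j : 'I_N.+1) : 0 <= b * (e `^ r - v j `^ r).
  by rewrite mulr_ge0// subr_ge0 pmono// ve// ltnW.
pose E (i : 'I_K * 'I_N.+1) := U i.1 @^-1` `[v i.2, v (nat_of_ord i.2).+1[.
have mE i : measurable (E i).
  by rewrite -[E i]setTI; exact: measurable_funP.
have PE i : P (E i) = (e / N.+1%:R)%:E.
  transitivity (uniform_prob (@ltr01 R) `[v i.2, v (nat_of_ord i.2).+1[).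
    by rewrite -(Uu i.1).
  rewrite uniform_prob_co// ?vS//; first exact: vmono.
  by apply: le_trans (ltW e1); apply: ve.
have wc := @weighted_cover _ _ _ P _ a E A mA mE.
apply: le_trans (wc _ _) _.
- by move=> i; rewrite mulr_ge0.
- move=> t At.
  have key k : b * (e `^ r - U k t `^ r) <=
      \sum_(j < N.+1) b * (e `^ r - v j `^ r) * \1_(E (k, j)) t.
    have [eU|Ue] := leP e (U k t).
      apply: (@le_trans _ _ 0); last by apply: sumr_ge0 => j _;
        rewrite mulr_ge0.
      by rewrite mulr_ge0_le0// subr_le0 pmono// ltW.
    have x0 : 0 <= U k t * N.+1%:R / e.
      by rewrite divr_ge0 ?mulr_ge0 ?U0// ltW.
    have jN : (Num.trunc (U k t * N.+1%:R / e) < N.+1)%N.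
      by rewrite truncn_lt_nat// ltr_pdivrMr// mulrC ltr_pM2l.
    rewrite (bigD1 (Ordinal jN))//= -[leLHS]addr0; apply: lerD; last first.
      by apply: sumr_ge0 => j _; rewrite mulr_ge0.
    have lj : v (Num.trunc (U k t * N.+1%:R / e)) <= U k t.
      rewrite /v ler_pdivrMr// mulrC -ler_pdivlMr//.
      by rewrite -truncn_ge_nat.
    rewrite indicE mem_set ?mulr1; last first.
      rewrite /E/= in_itv/= lj/= /v ltr_pdivlMr// [ltRHS]mulrC -ltr_pdivrMr//.
      exact: truncnS_gt.
    by rewrite ler_wpM2l// lerD2l lerN2 pmono.
  apply: (@le_trans _ _ (\sum_k tnth w k * (b * (e `^ r - U k t `^ r)))).
    under eq_bigr do rewrite mulrCA.
    rewrite -mulr_sumr; under eq_bigr do rewrite mulrBr.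
    rewrite sumrB -mulr_suml w1 mul1r.
    have h : (r + 1) * (e `^ r - e `^ r / (r + 1)) / (r * e `^ r) = 1.
      by field; rewrite !gt_eqF// addr_gt0.
    rewrite -[leLHS]h mulrAC -/b ler_wpM2l// lerD2l lerN2.
    by rewrite ler_pdivlMr ?addr_gt0// mulrC US.
  rewrite (eq_bigr (fun i : 'I_K * 'I_N.+1 => tnth w i.1 *
      (b * (e `^ r - v i.2 `^ r) * \1_(E (i.1, i.2)) t))); last first.
    by move=> [k j] _; rewrite /a /= -mulrA.
  rewrite -(pair_bigA _ (fun (k : 'I_K) (j : 'I_N.+1) => tnth w k *
      (b * (e `^ r - v j `^ r) * \1_(E (k, j)) t)))/=.
  by apply: ler_sum => k _; rewrite -mulr_sumr ler_wpM2l.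
under eq_bigr do rewrite PE -EFinM.
rewrite sumEFin lee_fin -mulr_suml.
rewrite -(pair_bigA _ (fun (k : 'I_K) (j : 'I_N.+1) => tnth w k * (b * (e `^ r
  - v j `^ r))))/=.
under eq_bigr do rewrite -mulr_sumr.
rewrite -mulr_suml w1 mul1r -mulr_sumr.
have tel (s : R) : 0 < s ->
    \sum_(j < N.+1) (v j.+1 `^ s - v j `^ s) = e `^ s.
  move=> s0; rewrite -(big_mkord xpredT (fun j => v j.+1 `^ s - v j `^ s)).
  by rewrite telescope_sumr// vN v00 powR0 ?subr0 ?gt_eqF.
have er : e `^ (r + 1) = e `^ r * e.
  by rewrite powRD ?powRr1 ?ltW// gt_eqF// addr_gt0.
have S1 : \sum_(j < N.+1) (e `^ r - v j `^ r) * (e / N.+1%:R) <=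
    e `^ (r + 1) - e `^ (r + 1) / (r + 1) + e `^ r * (e / N.+1%:R).
  have step (j : 'I_N.+1) : (e `^ r - v j `^ r) * (e / N.+1%:R) <=
      e `^ r * (e / N.+1%:R) - (v j.+1 `^ (r + 1) - v j `^ (r + 1)) / (r + 1)
      + (v j.+1 `^ r - v j `^ r) * (e / N.+1%:R).
    have := powR_tangent r0 (v0 j) (v0 j.+1).
    have -> : v j - v j.+1 = - (e / N.+1%:R) by rewrite -(vS j); ring.
    have -> : (v j `^ (r + 1) - v j.+1 `^ (r + 1)) / (r + 1) =
      - ((v j.+1 `^ (r + 1) - v j `^ (r + 1)) / (r + 1)) by ring.
    rewrite mulrN lerN2; set h := e / _; set D := (_ - _) / _ => H.
    rewrite !(mulrBl h); move: H.
    set x := _ * h; set y := _ * h; set z := _ * h; lra.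
  apply: le_trans (ler_sum _ (fun j _ => step j)) _.
  rewrite big_split/= sumrB sumr_const card_ord -mulr_suml -mulr_suml.
  rewrite !tel ?addr_gt0// er -[_ *+ _]mulr_natr.
  rewrite (_ : e `^ r * (e / N.+1%:R) * N.+1%:R = e `^ r * e)//.
  by field; rewrite gt_eqF.
have S2 := ler_wpM2l b0 S1.
rewrite -mulrA mulr_suml; apply: le_trans S2 _.
rewrite er /b.
have -> : (r + 1) / (r * e `^ r) * (e `^ r * e - e `^ r * e / (r + 1) +
    e `^ r * (e / N.+1%:R)) = e + (1 + r^-1) * e / N.+1%:R.
  by field; rewrite !gt_eqF// addr_gt0.
rewrite lerD2l ler_pM2r ?invr_gt0//.
have : r^-1 <= 1 by rewrite invf_le1.
have : 0 <= r^-1 by rewrite invr_ge0 ltW.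
nra.
Qed.

(** * The scaled weighted mean *)

Lemma measurable_cube (R : realType) (K : nat) : measurable (@cube R K).
Proof.
rewrite (_ : @cube R K =
    \bigcap_(k in [set: 'I_K]) ((fun x => tnth x k) @^-1` `[0, 1])).
  apply: fin_bigcap_measurable => [|k _]; first exact: finite_finset.
  by rewrite -[X in measurable X]setTI; exact: measurable_tnth.
apply/seteqP; split=> x /=.
  by move=> H k _; rewrite /= in_itv/=; exact: H.
by move=> H k; have := H k I; rewrite /= in_itv.
Qed.

Lemma measurable_merging_event d (T : measurableType d) (R : realType)
    (P : probability T R) (K : nat) (F : K.-tuple R -> R)
    (U : 'I_K -> {RV P >-> R}) (e : R) :
  measurable_fun (@cube R K) F -> measurable (merging_event F U e).
Proof.
move=> mF; pose Phi t := [tuple U k t | k < K].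
have mPhi : measurable_fun setT Phi.
  apply/measurable_fun_tnthP => k.
  rewrite (_ : _ \o _ = U k); first exact: measurable_funP.
  by apply/funext => t; rewrite /= tnth_mktuple.
rewrite (_ : merging_event F U e =
  Phi @^-1` (@cube R K `&` F @^-1` `]-oo, e])).
  rewrite -[X in measurable X]setTI; apply: mPhi => //.
  by apply: mF => //; exact: measurable_cube.
by apply/seteqP; split=> t /=; rewrite in_itv.
Qed.

Lemma max_weightP (R : realType) (K : nat) (w : K.-tuple R) : simplex w ->
  [/\ forall k, 0 <= tnth w k, 0 < max_weight w,
    forall k, tnth w k <= max_weight w &
    exists k, max_weight w = tnth w k].
Proof.
move=> [w01 w1].
have w0 k : 0 <= tnth w k by case/andP: (w01 k).
have wm k : tnth w k <= max_weight w by exact: le_bigmax.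
have [k wk] : exists k, 0 < tnth w k.
  apply: contrapT => H; have := @ltr01 R; rewrite -w1 big1 ?ltxx// => k _.
  by apply/eqP; rewrite eq_le w0 andbT leNgt; apply/negP => wk; apply: H;
    exists k.
split => //; first exact: lt_le_trans wk (wm k).
rewrite /max_weight; have [i _ ->] := @eq_bigmax _ _ _ 0 k predT (tnth w) isT
  (fun i _ => w0 i).
by exists i.
Qed.

Lemma big_option (R : realType) (I : finType) (F : option I -> R) :
  \sum_o F o = F None + \sum_i F (Some i).
Proof.
rewrite (bigD1 None)//=; congr (_ + _).
by rewrite (reindex_omap Some id) => [|[]//]; apply: eq_bigl => i; rewrite eqxx.
Qed.

Lemma marginal_cumulative (R : realType) (K n : nat) (p : grid K n -> R) k m :
  \sum_(x : grid K n | (x k < m)%N) p x = \sum_(j < m) marginal p k j.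
Proof.
elim: m => [|m IH]; first by rewrite big_ord0 big_pred0.
rewrite big_ord_recr/= -IH (bigID (fun x : grid K n => x k == m :> nat))/=
  addrC.
congr (_ + _); apply: eq_bigl => x; last first.
  by case: eqVneq => [->|]; rewrite ?ltnSn ?andbF.
by rewrite ltnS [RHS]ltn_neqAle andbC.
Qed.

Section precise.
Variables (R : realType) (K : nat) (w : K.-tuple R) (r : R).
Hypothesis hw : simplex w.
Hypothesis hr : 1 <= r.

Let c := Num.min (r + 1) (1 / max_weight w).
Let F (p : K.-tuple R) := c `^ r^-1 * weighted_mean r w p.
Let S (p : K.-tuple R) := \sum_(k < K) tnth w k * tnth p k `^ r.

Let r0 : 0 < r. Proof. exact: lt_le_trans hr. Qed.
Let w0 k : 0 <= tnth w k. Proof. by case: (max_weightP hw). Qed.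
Let c0 : 0 < c.
Proof.
rewrite lt_min addr_gt0// divr_gt0//; by case: (max_weightP hw).
Qed.
Let S0 p : 0 <= S p.
Proof. by apply: sumr_ge0 => k _; rewrite mulr_ge0// powR_ge0. Qed.

Lemma scaled_meanE p : F p = (c * S p) `^ r^-1.
Proof. by rewrite powRM// ltW. Qed.

Lemma scaled_mean_le p e : 0 <= e -> (F p <= e) = (c * S p <= e `^ r).
Proof.
move=> e0; have cS0 : 0 <= c * S p by rewrite mulr_ge0// ltW.
have rr x : 0 <= x -> (x `^ r) `^ r^-1 = x.
  by move=> x0; rewrite -powRrM mulfV ?gt_eqF// powRr1.
have rr' x : 0 <= x -> (x `^ r^-1) `^ r = x.
  by move=> x0; rewrite -powRrM mulVf ?gt_eqF// powRr1.
rewrite scaled_meanE; apply/idP/idP => H.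
  rewrite -[leLHS]rr'//; apply: ge0_ler_powR; rewrite ?nnegrE ?powR_ge0//.
  exact: ltW.
rewrite -[leRHS]rr//; apply: ge0_ler_powR; rewrite ?nnegrE ?powR_ge0//.
by rewrite invr_ge0 ltW.
Qed.

Lemma measurable_scaled_mean : measurable_fun (@cube R K) F.
Proof.
apply: measurable_funTS; apply: measurable_funM => //.
apply: (measurableT_comp (@measurable_powR R r^-1)).
apply: measurable_sum => k; apply: measurable_funM => //.
apply: (measurableT_comp (@measurable_powR R r)); exact: measurable_tnth.
Qed.

Lemma scaled_mean_mono (k : 'I_K) (x y : K.-tuple R) : cube x -> cube y ->
  (forall j, j != k -> tnth x j = tnth y j) ->
  tnth x k <= tnth y k -> F x <= F y.
Proof.
move=> cx cy xy xyk; rewrite !scaled_meanE.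
have SS : S x <= S y.
  apply: ler_sum => j _; rewrite ler_wpM2l//.
  have [->|jk] := eqVneq j k; last by rewrite xy.
  apply: ge0_ler_powR; rewrite ?nnegrE//; first exact: ltW.
  - by case/andP: (cx k).
  - by case/andP: (cy k).
apply: ge0_ler_powR; rewrite ?nnegrE ?mulr_ge0// ?invr_ge0 ?(ltW r0) ?(ltW
  c0)//.
by rewrite ler_pM2l.
Qed.

Variables (d : measure_display) (T : measurableType d) (P : probability T R).

Lemma scaled_mean_valid (U : 'I_K -> {RV P >-> R}) (e : R) : 0 < e < 1 ->
  (forall k, uniform01 (U k)) -> (P (merging_event F U e) <= e%:E)%E.
Proof.
move=> e01 Uu; have /andP[e0 e1] := e01.
have mE := measurable_merging_event U e measurable_scaled_mean.
have SE t : merging_event F U e t ->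
    c * \sum_k tnth w k * U k t `^ r <= e `^ r.
  move=> [_]; rewrite scaled_mean_le ?(ltW e0)// /S.
  by under eq_bigr do rewrite tnth_mktuple.
have U0 t k : merging_event F U e t -> 0 <= U k t.
  by move=> [/(_ k)]; rewrite tnth_mktuple => /andP[].
have [cr|cr] := leP (r + 1) (1 / max_weight w).
  apply: (weighted_power_tail hw hr e01 Uu mE U0) => t /SE.
  by rewrite /c min_l.
have [_ wm0 _ [k wk]] := max_weightP hw.
apply: (@le_trans _ _ (P (U k @^-1` `]-oo, e]))).
  apply: le_measure; rewrite ?inE//; first exact: mfun_preimage.
  move=> t Et /=; rewrite in_itv/= leNgt; apply/negP => eU.
  have cE : c = 1 / max_weight w by rewrite /c min_r// ltW.
  have := SE t Et; rewrite cE leNgt => /negP; apply.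
  rewrite mul1r ltr_pdivlMl//.
  rewrite (bigD1 k)//= -wk -[ltLHS]addr0 ltr_leD//.
    rewrite ltr_pM2l//; apply: gt0_ltr_powR => //; rewrite nnegrE;
      first exact: ltW.
    exact: U0 Et.
  by apply: sumr_ge0 => j _; rewrite mulr_ge0// powR_ge0.
rewrite -[X in (X <= _)%E]/(distribution P (U k) _) Uu//.
by rewrite uniform_prob_le// !ltW.
Qed.

Hypothesis hP : atomless P.

(** The grid step is m / n with m = 1 / c, so that the supports of the
    variables w_k V_k^r fit in n steps.  Rounding to the grid costs K steps and
    [joint_mix] costs K + 3 steps; n is so large that this is absorbed by
    replacing e' with e. *)
Lemma scaled_mean_attained (e' e : R) : 0 < e' -> e' < e -> e < 1 ->
  exists U : 'I_K -> {RV P >-> R}, (forall k, uniform01 (U k)) /\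
    (e'%:E <= P (merging_event F U e))%E.
Proof.
move=> e'0 e'e e1.
have [_ wm0 wmax [k0 _]] := max_weightP hw.
have K0 : (0 < K)%N := leq_ltn_trans (leq0n k0) (ltn_ord k0).
pose m := c^-1; have m0 : 0 < m by rewrite invr_gt0.
have mw k : tnth w k <= m.
  apply: le_trans (wmax k) _; rewrite -[leLHS]invrK lef_pV2 ?posrE ?invr_gt0//.
  by rewrite ge_min div1r lexx orbT.
have mr : (r + 1)^-1 <= m.
  by rewrite lef_pV2 ?posrE ?addr_gt0// ge_min lexx.
pose A : R := (K + K + 3)%:R.
(* This n gives e' (1 + A / n) <= e, where A is the number of lost steps. *)
pose n := (Num.trunc (A * e' / (e - e'))).+1.
have n0 : (0 < n)%N by [].
have nR : (0 : R) < n%:R by [].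
have nA : e' * (1 + A / n%:R) <= e.
  have := truncnS_gt (A * e' / (e - e')); rewrite -/n.
  rewrite ltr_pdivrMr ?subr_gt0// => H.
  rewrite mulrDr mulr1 -lerBrDl mulrA ler_pdivrMr// [leRHS]mulrC [e' * A]mulrC.
  exact: ltW.
pose dl := m / n%:R; have dl0 : 0 < dl by rewrite divr_gt0.
have wn k : tnth w k <= n%:R * dl by rewrite mulrC divfK// gt_eqF.
have /fin_all_exists[q qP] k := discrete_quantile hr (w0 k) dl0 (wn k).
pose f k j := q k j.+1 - q k j.
have q00 k : q k 0%N = 0 by case: (qP k).
have q1 k j : (n <= j)%N -> q k j = 1.
  by move=> nj; case: (qP k) => _ _ [_ H] _ _; apply: H => //;
    exact: leq_trans nj.
have qsum k j : \sum_(i < j) f k i = q k j.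
  by rewrite -(big_mkord xpredT (f k)) telescope_sumr// q00 subr0.
have [||||||p [p0 ps pm]] := @joint_mix R K n f.
- by [].
- by [].
- by move=> k j; case: (qP k) => _ _ [H _] _ _; exact: H.
- by move=> k j nj; rewrite /f !q1 ?subrr// ltnW// ltnW.
- by move=> k; rewrite qsum q1.
- rewrite -(ler_pM2r dl0) mulr_suml.
  apply: (@le_trans _ _ (\sum_k tnth w k / (r + 1))).
    apply: ler_sum => k _; rewrite mulr_suml; case: (qP k) => _ _ _ _ H.
    apply: le_trans H; rewrite le_eqVlt; apply/orP; left; apply/eqP.
    by apply: eq_bigr => j _; rewrite mulrAC.
  case: hw => _ w1; rewrite -mulr_suml w1 mul1r.
  by rewrite mulrC divfK ?gt_eqF.
have psum : \sum_x p x = 1.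
  rewrite -(marginal_sum p (Ordinal K0)) -[RHS](q1 (Ordinal K0) n.+1)//.
  by rewrite -qsum; apply: eq_bigr => j _; rewrite pm.
have e'p0 x : 0 <= e' * p x by rewrite mulr_ge0// ltW.
have e'p1 : \sum_x e' * p x <= 1.
  by rewrite -mulr_sumr psum mulr1 ltW// (lt_trans e'e).
have [J [mJ PJ]] := finite_law hP e'p0 e'p1.
(* Outside the part of mass e' the variables are placed above all the cells
   of the grid. *)
pose idx k (o : option (grid K n)) : nat := if o is Some x then x k else n.+1.
have /fin_all_exists2[U Uu UP] k := layered_uniform hP (idx k) mJ.
exists U; split => //.
pose Q (o : option (grid K n)) := if o is Some x then p x != 0 else false.
pose E := [set t | Q (J t)].
have UE t x : J t = Some x -> forall k, U k t <= e' * q k (x k).+1.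
  move=> Jt k; have [_] := UP k t; rewrite Jt /= => /le_trans; apply.
  have nx : (n < x k)%N = false by rewrite ltnNge -ltnS ltn_ord.
  rewrite big_mkcond big_option /= nx add0r -big_mkcond/=.
  under eq_bigr do rewrite PJ /=.
  rewrite -mulr_sumr (eq_bigl (fun y : grid K n => (y k < (x k).+1)%N))//.
  rewrite marginal_cumulative; under eq_bigr do rewrite pm.
  by rewrite qsum.
have mE : measurable E := measurable_finite_pred Q mJ.
have PE : P E = e'%:E.
  rewrite -[LHS]fineK ?fin_num_measure//; congr EFin.
  rewrite -(sum_fibers P Q mJ) big_mkcond big_option /= add0r.
  rewrite -[RHS]mulr1 -psum mulr_sumr; apply: eq_bigr => x _.
  by rewrite PJ; case: eqVneq => //= ->; rewrite mulr0.
rewrite -PE; apply: le_measure.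
- by rewrite inE.
- rewrite inE; exact: measurable_merging_event measurable_scaled_mean.
move=> t; rewrite /E/Q/=; case Jt : (J t) => [x|//] px.
have U0 k : 0 <= U k t by case: (UP k t).
have qle k j : 0 <= q k j <= 1.
  have qmono i i' : (i <= i')%N -> q k i <= q k i'.
    by case: (qP k) => _ /nondecreasing_seqP H _ _ _; exact: H.
  have h0 : 0 <= q k j by rewrite -(q00 k) qmono.
  by rewrite h0 -(q1 k (maxn j n)) ?leq_maxr// qmono// leq_maxl.
split.
  move=> k; rewrite tnth_mktuple U0/=.
  apply: le_trans (UE t x Jt k) _; have /andP[h0 h1] := qle k (x k).+1.
  by apply: mulr_ile1 => //; [exact: ltW|exact: ltW (lt_trans e'e e1)].
have e0 : 0 < e by exact: lt_trans e'e.
rewrite scaled_mean_le ?(ltW e0)// /S.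
under eq_bigr do rewrite tnth_mktuple.
have xs : (\sum_k (x k).+1 <= n + (K + K + 3))%N.
  rewrite (eq_bigr (fun k => x k + 1)%N) => [|k _]; last by rewrite addn1.
  rewrite big_split/= sum_nat_const card_ord muln1.
  apply: (@leq_trans (n + (K + 3) + K)); first by rewrite leq_add2r ps.
  by rewrite -addnA leq_add2l addnAC.
apply: (@le_trans _ _ (c * (e' `^ r * \sum_k (x k).+1%:R * dl))).
  rewrite ler_pM2l// mulr_sumr; apply: ler_sum => k _.
  apply: (@le_trans _ _ (tnth w k * (e' `^ r * q k (x k).+1 `^ r))).
    rewrite ler_wpM2l// -powRM ?(ltW e'0)//;
      last by case/andP: (qle k (x k).+1).
    have qk0 : 0 <= q k (x k).+1 by case/andP: (qle k (x k).+1).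
    apply: ge0_ler_powR; rewrite ?nnegrE ?mulr_ge0 ?(ltW e'0) ?(ltW r0)//.
    exact: UE.
  rewrite mulrCA ler_wpM2l ?powR_ge0//; case: (qP k) => _ _ _ H _; exact: H.
rewrite -mulr_suml -natr_sum.
apply: (@le_trans _ _ (e' `^ r * (1 + A / n%:R))).
  rewrite mulrCA ler_wpM2l ?powR_ge0// mulrCA.
  have -> : c * dl = n%:R^-1 by rewrite /dl /m mulrA divff ?mul1r ?gt_eqF.
  rewrite ler_pdivrMr// mulrDl mul1r divfK ?gt_eqF// -natrD ler_nat.
  exact: xs.
have A1 : 1 <= 1 + A / n%:R by rewrite lerDl divr_ge0.
apply: (@le_trans _ _ ((e' * (1 + A / n%:R)) `^ r)).
  rewrite powRM ?(ltW e'0)//; last exact: le_trans A1.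
  rewrite ler_wpM2l ?powR_ge0// -[leLHS]powRr1; last exact: le_trans A1.
  exact: ler_powR.
apply: ge0_ler_powR => //; rewrite ?nnegrE ?(ltW r0) ?(ltW e0)//.
by rewrite mulr_ge0 ?(ltW e'0)// (le_trans _ A1).
Qed.

End precise.

Unset Implicit Arguments.

Theorem mainTheorem11 (R : realType) (d : measure_display)
    (T : measurableType d) (P : probability T R) (hP : atomless P)
    (K : nat) (hK : (2 <= K)%N) (w : K.-tuple R) (hw : simplex w)
    (r : R) (hr : 1 <= r) :
  precise_merging_function P
    (fun p : K.-tuple R =>
       Num.min (r + 1) (1 / max_weight w) `^ r^-1 * weighted_mean r w p).
Proof.
set F := fun p : K.-tuple R => _.
have valid (e : R) : 0 < e < 1 -> (merging_sup P F e <= e%:E)%E.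
  move=> e01; apply: ge_ereal_sup => _ [U [Uu ->]].
  exact: scaled_mean_valid.
split.
  split; [exact: measurable_scaled_mean| | |exact: valid].
    by move=> x _; rewrite mulr_ge0 ?powR_ge0.
  by move=> k x y; exact: scaled_mean_mono.
move=> e e01; apply/eqP; rewrite eq_le valid//=.
have /andP[e0 e1] := e01.
apply/lee_addgt0Pr => x x0.
have h0 : 0 < Num.max (e - x) (e / 2) by rewrite lt_max divr_gt0 ?orbT.
have h1 : Num.max (e - x) (e / 2) < e by rewrite gt_max; apply/andP; split; lra.
have [U [Uu Ue]] := scaled_mean_attained hw hr hP h0 h1 e1.
apply: (@le_trans _ _ ((Num.max (e - x) (e / 2))%:E + x%:E)%E).
  by rewrite -EFinD lee_fin -lerBlDr le_max lexx.
rewrite leeD2r//; apply: le_trans Ue _.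
by apply: ereal_sup_ubound; exists U.
Qed.
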